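(* Let $A\subset X$. Then $\overline{A}^1=A\cup b_1A$ and \[ \partial^1A=(A\cap b_1(X\setminus A))\cup((X\setminus A)\cap b_1A). \]
   Context: Setting. $(X,d,\mu)$ is a complete metric space with at least two points, equipped with a Borel regular outer measure $\mu$ that is doubling: there is $C_d\ge 1$ with $0<\mu(B(x,2r))\le C_d\,\mu(B(x,r))<\infty$ for every ball $B(x,r)$. A curve is a rectifiable continuous map from a compact interval into $X$, parametrized by arc-length, of length $\ell_\gamma$. A nonnegative Borel function $g$ is an upper gradient of an extended real-valued function $u$ on $X$ if $|u(x)-u(y)|\le\int_\gamma g\,ds$ for every curve $\gamma$ with end points $x,y$ (the left side is interpreted as $\infty$ if $|u(x)|$ or $|u(y)|$ is infinite). $X$ supports a $(1,1)$-Poincaré inequality: there are $C_P\ge1$, $\lambda\ge1$ such that $\frac{1}{\mu(B(x,r))}\int_{B(x,r)}|u-u_{B(x,r)}|\,d\mu\le C_P r\,\frac{1}{\mu(B(x,\lambda r))}\int_{B(x,\lambda r)}g\,d\mu$ for all balls, all locally integrable $u$ and all upper gradients $g$ of $u$, where $u_{B}$ is the mean value of $u$ over $B$. Newton–Sobolev space. A family $\Gamma$ of curves has zero $1$-modulus if there is a nonnegative Borel $\rho\in L^1(X)$ with $\int_\gamma\rho\,ds=\infty$ for all $\gamma\in\Gamma$; a nonnegative $\mu$-measurable $g$ is a $1$-weak upper gradient of $u$ if the upper gradient inequality holds for all curves outside a family of zero $1$-modulus. $\|u\|_{N^{1,1}(X)}=\|u\|_{L^1(X)}+\inf\|g\|_{L^1(X)}$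 over $1$-weak upper gradients $g$ of $u$, and $N^{1,1}(X)=\{u:\|u\|_{N^{1,1}(X)}<\infty\}$ (functions defined everywhere). Variational capacity. For $A\subset D\subset X$, $\mathrm{cap}_1(A,D)=\inf\int_X g_u\,d\mu$ over all $u\in N^{1,1}(X)$ and upper gradients $g_u$ of $u$ with $u\ge1$ in $A$ and $u=0$ in $X\setminus D$. $1$-fine topology. $A\subset X$ is $1$-thin at $x\in X$ if $\lim_{r\to0} r\,\mathrm{cap}_1(B(x,r)\cap A,B(x,2r))/\mu(B(x,r))=0$. A set $U$ is $1$-finely open if $X\setminus U$ is $1$-thin at every $x\in U$; the $1$-finely open sets form a topology. For $G\subset X$, $\text{fine-int}\,G$ is the largest $1$-finely open set contained in $G$, $\overline{G}^1$ is the smallest $1$-finely closed set containing $G$, $\partial^1G=\overline G^1\setminus\text{fine-int}\,G$, and the $1$-base $b_1G$ is the set of points of $X$ at which $G$ is not $1$-thin. *)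

(* Defs.v *)
From HB Require Import structures.
From mathcomp Require Import all_boot all_order all_algebra.
From mathcomp Require Import all_classical all_reals all_analysis.
From mathcomp Require Import measurable_realfun.

Set Implicit Arguments.
Unset Strict Implicit.
Unset Printing Implicit Defensive.

Import Order.TTheory GRing.Theory Num.Theory.
Import numFieldNormedType.Exports.

Local Open Scope classical_set_scope.
Local Open Scope ring_scope.
Local Open Scope ereal_scope.

(* The library defines measurable structures on pointed types only, hence the
   base point; it plays no role in the definitions below. *)
#[short(type="completePMetricType")]
HB.structure Definition CompletePMetric (R : numDomainType) :=
  { M of Metric R M & Complete M & Pointed M }.

Section curves.
Context {R : realType} {X : completePMetricType R}.

Definition curve_variation (a b : R) (f : R -> X) (s : seq R) : R :=
  let F := f \o nth b (a :: s) in
  (\sum_(0 <= n < size s) mdist (F n) (F n.+1))%R.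

Definition curve_length (a b : R) (f : R -> X) : \bar R :=
  ereal_sup [set (curve_variation a b f s)%:E | s in itv_partition a b].

(* A rectifiable curve parametrized by arc-length on [0, len]; the values of
   the path outside [0, len] are irrelevant. Constant curves (len = 0) are
   included. *)
Record curve := Curve {
  len : R ;
  path_of :> R -> X ;
  len_ge0 : (0 <= len)%R ;
  path_continuous : {within `[0%R, len], continuous path_of} ;
  path_arc_length : forall t : R, (0 <= t <= len)%R ->
    curve_length 0 t path_of = t%:E }.

(* For a nonnegative integrand the library's integral is the supremum of the
   integrals of the simple functions below it, so that it is the usual one
   also if g \o gamma is only measurable with respect to the completed
   Lebesgue sigma-algebra. *)
Definition curve_integral (gamma : curve) (g : X -> \bar R) : \bar R :=
  \int[lebesgue_measure]_(t in `[0%R, len gamma]) g (gamma t).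

Definition borel_fun (g : X -> \bar R) :=
  measurable_fun setT (g : g_sigma_algebraType (@open X) -> \bar R).

(* In \bar R, +oo - +oo = -oo, so the left-hand side is +oo as soon as one of
   the two values is infinite. *)
Definition upper_gradient_along (u g : X -> \bar R) (gamma : curve) :=
  `|u (gamma 0%R) - u (gamma (len gamma))| <= curve_integral gamma g.

Definition upper_gradient (u g : X -> \bar R) :=
  [/\ forall x, 0 <= g x, borel_fun g &
      forall gamma : curve, upper_gradient_along u g gamma].

End curves.
Arguments curve {R} X.

Section measure.
Context {R : realType} {X : completePMetricType R}.
Variable mu : {outer_measure set X -> \bar R}.

(* mu restricted to its Caratheodory-measurable sets *)
Definition cara_measure : {measure set (caratheodory_type mu) -> \bar R} :=
  (mu : set (caratheodory_type mu) -> \bar R).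

Definition mu_measurable_fun (u : X -> \bar R) :=
  measurable_fun setT (u : caratheodory_type mu -> \bar R).

Definition borel_regular :=
  (forall B, <<s @open X >> B -> mu.-cara.-measurable B) /\
  (forall A, exists B, [/\ <<s @open X >> B, A `<=` B & mu B = mu A]).

Definition doubling := exists2 Cd : R, (1 <= Cd)%R &
  forall (x : X) (r : R), (0 < r)%R ->
  [/\ 0 < mu (ball x (2 * r)%R),
      mu (ball x (2 * r)%R) <= Cd%:E * mu (ball x r) &
      Cd%:E * mu (ball x r) < +oo].

Definition mean (u : X -> \bar R) (B : set X) : \bar R :=
  (\int[cara_measure]_(y in B) u y) / mu B.

Definition loc_integrable (u : X -> \bar R) :=
  forall x : X, exists2 r : R, (0 < r)%R &
    cara_measure.-integrable (ball x r) u.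

Definition poincare11 := exists CP lambda : R,
  [/\ (1 <= CP)%R, (1 <= lambda)%R &
    forall (x : X) (r : R), (0 < r)%R ->
    forall u g : X -> \bar R, loc_integrable u -> upper_gradient u g ->
    mean (fun y => `|u y - mean u (ball x r)|) (ball x r)
      <= (CP * r)%R%:E * mean g (ball x (lambda * r)%R)].

Definition zero_modulus (Gamma : set (curve X)) :=
  exists rho : X -> \bar R,
    [/\ forall x, 0 <= rho x, borel_fun rho,
        cara_measure.-integrable setT rho &
        forall gamma, Gamma gamma -> curve_integral gamma rho = +oo].

Definition weak_upper_gradient (u g : X -> \bar R) :=
  [/\ forall x, 0 <= g x, mu_measurable_fun g &
    exists2 Gamma : set (curve X), zero_modulus Gamma &
      forall gamma, ~ Gamma gamma -> upper_gradient_along u g gamma].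

Definition N11_norm (u : X -> \bar R) : \bar R :=
  \int[cara_measure]_x `|u x| +
  ereal_inf [set \int[cara_measure]_x g x | g in weak_upper_gradient u].

Definition N11 : set (X -> \bar R) :=
  [set u | mu_measurable_fun u /\ N11_norm u < +oo].

Definition cap1 (A D : set X) : \bar R :=
  ereal_inf [set c | exists u g : X -> \bar R,
    [/\ N11 u /\ upper_gradient u g,
        forall x, A x -> 1 <= u x,
        forall x, ~ D x -> u x = 0 &
        c = \int[cara_measure]_x g x]].

Definition thin (A : set X) (x : X) :=
  r%:E * cap1 (ball x r `&` A) (ball x (2 * r)%R) / mu (ball x r)
    @[r --> (0 : R)^'+] --> (0 : \bar R).

Definition finely_open (U : set X) := forall x, U x -> thin (~` U) x.

Definition finely_closed (F : set X) := finely_open (~` F).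

Definition fine_int (G : set X) : set X :=
  \bigcup_(U in [set U | finely_open U /\ U `<=` G]) U.

Definition fine_closure (G : set X) : set X := smallest finely_closed G.

Definition fine_boundary (G : set X) : set X := fine_closure G `\` fine_int G.

Definition base1 (G : set X) : set X := [set x | ~ thin G x].

End measure.

(* Main.v *)
Require Import Defs.
From mathcomp Require Import finmap.
From mathcomp Require Import all_boot all_order all_algebra.
From mathcomp Require Import all_classical all_reals all_analysis.
From mathcomp Require Import measurable_realfun.
From mathcomp Require Import ring lra.
Set Implicit Arguments.
Unset Strict Implicit.
Unset Printing Implicit Defensive.

Import Order.TTheory GRing.Theory Num.Theory.
Import numFieldNormedType.Exports.

Local Open Scope classical_set_scope.
Local Open Scope ring_scope.
Local Open Scope ereal_scope.

(* It suffices to show that A `|` base1 A is thin at every point x where A is.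
   Take r small and a near optimal function q, with upper gradient g, for
   cap1 (ball x r `&` A, ball x (2 * r)). A point y of ball x r in base1 A lies in
   - the set where the upper density of {q > 1/4} is at least 1/2, or
   - the set where s * (mean of g over ball y s) does not tend to 0 as s -> 0.
   Otherwise q is mostly below 1/4 near y, and the Poincare inequality makes
   min (2q - 1, cutoff), truncated at 0, a test function showing A thin at y.
   The second set has capacity 0 by a covering argument, since the bounded part
   of g does not contribute. The first set has capacity at most C \int g by a
   boxing argument: for a good level t, the truncations of q between t and t + h
   have energy bounded by C \int g as h -> 0 (a discrete coarea inequality),
   while stopping at the scale where {q > t} has intermediate density gives balls
   in which these truncations satisfy mu (ball) / radius <= C * energy. *)

(** * Curves *)

(** The reduction works because a finely closed set containing [A] contains every point at which [A]
    is not thin; only the fine closedness of the union of [A] and [base1 mu A] is in question. The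
    obstacle is that the energy of a truncation of [q] must be confined to a level set, while an
    upper gradient has to be Borel and to obey its inequality along every curve. The level sets of a
    Caratheodory-measurable [q] are therefore enlarged to Borel sets, up to null sets, and an extra
    term, [g] itself or a small multiple of it, has infinite integral along the curves for which the
    cutting is not justified. In the boxing argument only finitely many disjoint balls are compared
    with an energy at a time. One width [h] then serves all of them, and it is enough that the
    difference quotients of the energy at [t] are bounded for arbitrarily small [h]. The two
    distinct points keep small balls away from some [p]. Thus [q] vanishes on a sizeable part of
    [ball x (4 * r)], and the Poincare inequality bounds [q] itself instead of its oscillation. *)

Section curve_length.
Context {R : realType} {X : completePMetricType R}.
Implicit Types (f : R -> X) (s : seq R) (gamma : curve X).

Lemma curve_variation_cons (a b x : R) f s :
  curve_variation a b f (x :: s) =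
  (mdist (f a) (f x) + curve_variation x b f s)%R.
Proof. by rewrite /curve_variation /= big_nat_recl. Qed.

Lemma curve_variation_cat (a b c : R) f s1 s2 : itv_partition a c s1 ->
  curve_variation a b f (s1 ++ s2) =
  (curve_variation a c f s1 + curve_variation c b f s2)%R.
Proof.
elim: s1 a => [a /itv_partition_nil ->|x s1 IH a /itv_partition_cons/IH H].
  by rewrite /= {2}/curve_variation big_nil add0r.
by rewrite /= !curve_variation_cons H addrA.
Qed.

Lemma curve_variation_ge0 (a b : R) f s : (0 <= curve_variation a b f s)%R.
Proof. by apply: sumr_ge0 => i _; exact: mdist_ge0. Qed.

Lemma curve_variation_le (a b : R) f s : itv_partition a b s ->
  (curve_variation a b f s)%:E <= curve_length a b f.
Proof. by move=> abs; apply: ereal_sup_ubound; exists s. Qed.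

Lemma mdist_le_curve_length (a b : R) f : (a <= b)%R ->
  (mdist (f a) (f b))%:E <= curve_length a b f.
Proof.
rewrite le_eqVlt => /predU1P[->|ab].
  rewrite mdistxx (le_trans _ (@curve_variation_le b b f [::] _))//.
  by rewrite lee_fin curve_variation_ge0.
apply: le_trans (curve_variation_le f (itv_partition1 ab)).
by rewrite curve_variation_cons /curve_variation big_nil addr0.
Qed.

Lemma curve_length_ge0 (a b : R) f : (a <= b)%R -> 0 <= curve_length a b f.
Proof.
by move=> ab; apply: le_trans (mdist_le_curve_length f ab); rewrite lee_fin mdist_ge0.
Qed.

(** By the triangle inequality, inserting [c] into the partition does not decrease the variation.
    The induction locates the step of the partition that straddles [c]. *)
Lemma curve_variation_leD (a b c : R) f s : (a <= c <= b)%R ->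
  itv_partition a b s ->
  (curve_variation a b f s)%:E <= curve_length a c f + curve_length c b f.
Proof.
elim: s a => [a /andP[ac cb] _|x s IH a /andP[ac cb] abs].
  by rewrite /curve_variation big_nil adde_ge0// curve_length_ge0.
have xbs := itv_partition_cons abs.
have ax : (a < x)%R by case: abs => /= /andP[].
have [cx|xc] := leP c x.
  rewrite curve_variation_cons.
  apply: (@le_trans _ _ ((mdist (f a) (f c))%:E +
      ((mdist (f c) (f x))%:E + (curve_variation x b f s)%:E))).
    by rewrite -!EFinD lee_fin addrA lerD2r metric_triangle.
  apply: leeD; first exact: mdist_le_curve_length.
  move: cx; rewrite le_eqVlt => /predU1P[->|cx].
    by rewrite mdistxx add0e; exact: curve_variation_le.
  rewrite -EFinD -curve_variation_cons; apply: curve_variation_le.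
  by case: xbs => xs xl; split => //=; rewrite cx.
have := IH x; rewrite (ltW xc) cb => /(_ erefl xbs) xle.
rewrite curve_variation_cons EFinD.
apply: (@le_trans _ _ ((mdist (f a) (f x))%:E +
   (curve_length x c f + curve_length c b f))); first by rewrite leeD2l.
rewrite addeA leeD2r// addeC -leeBrDr//; apply: ge_ereal_sup => _ [l xcl <-].
rewrite leeBrDr// addeC -EFinD -curve_variation_cons; apply: curve_variation_le.
by case: xcl => xl ll; split => //=; rewrite ax.
Qed.

Lemma curve_lengthD (a b c : R) f : (a <= c <= b)%R ->
  curve_length a b f < +oo ->
  curve_length a b f = curve_length a c f + curve_length c b f.
Proof.
move=> /[dup] acb /andP[ac cb] aby; apply/eqP; rewrite eq_le; apply/andP; split.
  by apply: ge_ereal_sup => _ [s abs <-]; exact: curve_variation_leD.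
have H l : itv_partition c b l ->
    curve_length a c f + (curve_variation c b f l)%:E <= curve_length a b f.
  move=> cbl; rewrite -leeBrDr//; apply: ge_ereal_sup => _ [s acs <-].
  rewrite leeBrDr// -EFinD -curve_variation_cat//.
  by apply: curve_variation_le; exact: itv_partition_cat acs cbl.
(* Finiteness allows this length to be moved across the inequality in [\bar R]. *)
have fin : curve_length a c f \is a fin_num.
  rewrite ge0_fin_numE ?curve_length_ge0// (le_lt_trans _ aby)//.
  move: cb; rewrite le_eqVlt => /predU1P[->//|/(itv_partition1)/H].
  by apply: le_trans; rewrite leeDl// lee_fin curve_variation_ge0.
rewrite addeC -leeBrDr//; apply: ge_ereal_sup => _ [s cbs <-].
by rewrite leeBrDr// addeC H.
Qed.

Lemma curve_length_arc gamma (s t : R) : (0 <= s <= t)%R -> (t <= len gamma)%R ->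
  curve_length s t gamma = (t - s)%:E.
Proof.
move=> /andP[s0 st] tl.
have Lt := @path_arc_length _ _ gamma t; have Ls := @path_arc_length _ _ gamma s.
rewrite s0 (le_trans st tl) in Ls; rewrite (le_trans s0 st) tl in Lt.
have := @curve_lengthD 0 t s gamma; rewrite s0 st (Lt isT) (Ls isT) => /(_ isT).
rewrite ltry => /(_ isT); case: (curve_length s t gamma) => //= r.
by rewrite -EFinD => -[->]; rewrite addrC addKr.
Qed.

Lemma curve_mdist_le gamma (s t : R) : (0 <= s <= t)%R -> (t <= len gamma)%R ->
  (mdist (gamma s) (gamma t) <= t - s)%R.
Proof.
move=> st tl; rewrite -lee_fin -(@curve_length_arc gamma s t)//.
by apply: mdist_le_curve_length; case/andP : st.
Qed.

Lemma curve_length_shift_le (a b c : R) f :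
  curve_length a b (fun x => f (c + x)%R) <= curve_length (c + a) (c + b) f.
Proof.
apply: ge_ereal_sup => _ [s abs <-].
have -> : curve_variation a b (fun x => f (c + x)%R) s =
    curve_variation (c + a) (c + b) f [seq (c + x)%R | x <- s].
  elim: s a {abs} => [|x s IH] a; first by rewrite /curve_variation !big_nil.
  by rewrite /= !curve_variation_cons IH.
apply: curve_variation_le; case: abs => abs /eqP <-; split.
  by rewrite path_map (@eq_path _ _ <%R)// => x y /=; rewrite ltrD2l.
by rewrite last_map.
Qed.

Lemma curve_length_shift (a b c : R) f :
  curve_length a b (fun x => f (c + x)%R) = curve_length (c + a) (c + b) f.
Proof.
apply/eqP; rewrite eq_le curve_length_shift_le/=.
(* The reverse inequality is the same one for the shift by [- c]. *)
have := @curve_length_shift_le (c + a) (c + b) (- c) (fun x => f (c + x)%R).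
rewrite !addKr; congr (_ <= _); congr curve_length.
by apply/funext => x; rewrite addNKr.
Qed.

Lemma lipschitz_within_continuous (l : R) f :
  (forall s t : R, (0 <= s <= t)%R -> (t <= l)%R -> (mdist (f s) (f t) <= t - s)%R) ->
  {within `[0%R, l], continuous f}.
Proof.
move=> fL; apply/subspace_continuousP => x; rewrite /= in_itv/= => /andP[x0 xl].
apply/cvg_ballP => e e0; rewrite near_withinE/=.
exists e => //= y xy; rewrite in_itv/= => /andP[y0 yl].
rewrite ballEmdist/=; move: xy; rewrite /ball/= => xy.
have [xley|yltx] := leP x y.
  rewrite (le_lt_trans (fL _ _ _ _))// ?x0//.
  by move: xy; rewrite distrC ger0_norm// subr_ge0.
rewrite metric_sym (le_lt_trans (fL _ _ _ _))// ?y0 ?ltW//.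
by move: xy; rewrite ger0_norm// subr_ge0 ltW.
Qed.

(** Upper gradients are tested at the end points of curves only; subcurves give the inequality
    between any two parameters. *)
Lemma subcurve gamma (s t : R) : (0 <= s <= t)%R -> (t <= len gamma)%R ->
  exists2 eta : curve X, len eta = (t - s)%R & forall x, eta x = gamma (s + x)%R.
Proof.
move=> /andP[s0 st] tl.
have L0 : (0 <= t - s)%R by rewrite subr_ge0.
have C : {within `[0%R, (t - s)%R], continuous (fun x => gamma (s + x)%R)}.
  apply: lipschitz_within_continuous => a b /andP[a0 ab] bl.
  rewrite (le_trans (@curve_mdist_le gamma (s + a) (s + b) _ _))//.
  - by rewrite addr_ge0// lerD2l.
  - by rewrite (le_trans _ tl)// addrC -lerBrDr.
  - lra.
have A (x : R) : (0 <= x <= t - s)%R ->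
    curve_length 0 x (fun x => gamma (s + x)%R) = x%:E.
  move=> /andP[x0 xts]; rewrite curve_length_shift addr0 curve_length_arc//.
  - by rewrite addrC addKr.
  - by rewrite s0 lerDl.
  - by rewrite (le_trans _ tl)// addrC -lerBrDr.
by exists (Curve L0 C A).
Qed.

End curve_length.

(** * Integration *)

Section integral_lemmas.
Context d (T : measurableType d) {R : realType} (mu : {measure set T -> \bar R}).

Lemma ge0_integral_setU_le (A B : set T) (f : T -> \bar R) :
  measurable A -> measurable B -> measurable_fun (A `|` B) f ->
  (forall x, 0 <= f x) ->
  \int[mu]_(x in A `|` B) f x <= \int[mu]_(x in A) f x + \int[mu]_(x in B) f x.
Proof.
move=> mA mB mf f0; have mBA : measurable (B `\` A) by exact: measurableD.
have UE : A `|` B = A `|` (B `\` A) by rewrite setDE setUIr setUv setIT.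
rewrite UE ge0_integral_setU//; last 2 first.
- by rewrite -UE.
- by apply/disj_setPS => x [Ax [_ /(_ Ax)]].
apply: leeD2l; apply: ge0_subset_integral => //.
apply: measurable_funS mf; [exact: measurableU|exact: subsetUr].
Qed.

(** Monotone convergence along the sets where [g <= n]: their union misses only the points where [g]
    is infinite, a null set because [g] is integrable. *)
Lemma integral_tail_small (D : set T) (g : T -> \bar R) (e : R) :
  measurable D -> measurable_fun D g -> (forall x, 0 <= g x) ->
  \int[mu]_(x in D) g x < +oo -> (0 < e)%R ->
  exists n : nat, \int[mu]_(x in D `&` [set x | n%:R%:E < g x]) g x <= e%:E.
Proof.
move=> mD mg g0 gfin e0.
have mgt n : measurable (D `&` [set x | n%:R%:E < g x]).
  exact: emeasurable_fun_o_infty.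
have mle n : measurable (D `&` [set x | g x <= n%:R%:E]).
  exact: emeasurable_fun_infty_c.
have split n : \int[mu]_(x in D) g x =
    \int[mu]_(x in D `&` [set x | g x <= n%:R%:E]) g x +
    \int[mu]_(x in D `&` [set x | n%:R%:E < g x]) g x.
  have DE : D = (D `&` [set x | g x <= n%:R%:E]) `|` (D `&` [set x | n%:R%:E < g x]).
    rewrite -setIUr; apply/seteqP; split=> [x Dx|x []//]; split=> //=.
    by have [|] := leP (g x) n%:R%:E; [left|right].
  rewrite {1}DE ge0_integral_setU//.
  - by rewrite -DE.
  - apply/disj_setPS => x [[_ /= xn] [_ /=]]; by rewrite ltNge xn.
have cv : \int[mu]_(x in D `&` [set x | g x <= n%:R%:E]) g x @[n --> \oo]
    --> \int[mu]_(x in \bigcup_n (D `&` [set x | g x <= n%:R%:E])) g x.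
  apply: ge0_nondecreasing_set_cvg_integral => //.
  - move=> m n mn; apply/subsetPset => x [Dx /= gm]; split => //=.
    by rewrite (le_trans gm)// lee_fin ler_nat.
  - move=> n; apply: measurable_funS mg => //.
have fint (A : set T) : measurable A -> A `<=` D -> \int[mu]_(x in A) g x \is a fin_num.
  move=> mA AD; rewrite ge0_fin_numE ?integral_ge0// (le_lt_trans _ gfin)//.
  exact: ge0_subset_integral.
have Elim : \int[mu]_(x in \bigcup_n (D `&` [set x | g x <= n%:R%:E])) g x
    = \int[mu]_(x in D) g x.
  have gi : mu.-integrable D g.
    apply/integrableP; split=> //; under eq_integral do rewrite gee0_abs//.
    exact: gfin.
  have aef := integrable_ae mD gi.
  rewrite integral_mkcond [RHS]integral_mkcond.
  apply: ae_eq_integral => //.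
  - apply/(measurable_restrictT g) => //; first exact: bigcup_measurable.
    apply: measurable_funS mg => //; by move=> x [n _ []].
  - exact/(measurable_restrictT g).
  - move: aef; apply: filterS => x Dfin _.
    rewrite !patchE; case: ifPn; case: ifPn => //.
    + by rewrite !inE => nD [n _ [/mem_set Dx]]; rewrite Dx in nD.
    + rewrite inE => Dx /negP[]; rewrite inE.
      have /fineK gx := Dfin Dx.
      exists (Num.truncn (fine (g x))).+1 => //; split => //=.
      by rewrite -gx lee_fin ltW// truncnS_gt.
have := cv; rewrite Elim -(fineK (fint D mD (@subset_refl _ D))) => /fine_cvgP[_].
move=> /cvgrPdist_le/(_ e e0)[N _ /(_ N (leqnn N))] /=.
rewrite (split N) fineD ?fint//.
rewrite addrC addKr => eN; exists N.
rewrite -(fineK (fint _ (mgt N) _)) ?lee_fin; last by move=> x [].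
by rewrite (le_trans (ler_norm _)).
Qed.

Lemma integral_abs_continuous (D : set T) (g : T -> \bar R) (e : R) :
  measurable D -> measurable_fun D g -> (forall x, 0 <= g x) ->
  \int[mu]_(x in D) g x < +oo -> (0 < e)%R ->
  exists n : nat, forall A, measurable A -> A `<=` D ->
    \int[mu]_(x in A) g x <= n%:R%:E * mu A + e%:E.
Proof.
move=> mD mg g0 gfin e0.
have [n ne] := integral_tail_small mD mg g0 gfin e0; exists n => A mA AD.
have mgA : measurable_fun A g by exact: measurable_funS mg.
have mgt : measurable (A `&` [set x | n%:R%:E < g x]).
  exact: emeasurable_fun_o_infty.
have mle : measurable (A `&` [set x | g x <= n%:R%:E]).
  exact: emeasurable_fun_infty_c.
have DE : A = (A `&` [set x | g x <= n%:R%:E]) `|` (A `&` [set x | n%:R%:E < g x]).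
  rewrite -setIUr; apply/seteqP; split=> [x Dx|x []//]; split=> //=.
  by have [|] := leP (g x) n%:R%:E; [left|right].
rewrite {1}DE ge0_integral_setU//; last 2 first.
- by rewrite -DE.
- by apply/disj_setPS => x [[_ /= xn] [_ /=]]; rewrite ltNge xn.
apply: leeD.
- apply: (@le_trans _ _ (\int[mu]_(x in A `&` [set x | g x <= n%:R%:E]) n%:R%:E)).
    apply: ge0_le_integral => //.
    + by apply: measurable_funS mgA.
    + by move=> x [].
  rewrite integral_cst// lee_wpmul2l// ?lee_fin//.
  by apply: le_measure; rewrite ?inE// => x [].
- apply: le_trans ne; apply: ge0_subset_integral => //.
  + exact: emeasurable_fun_o_infty.
  + by apply: measurable_funS mg => // x [].
  + by move=> x [/AD].
Qed.

Lemma sum_integral_trivIset (I : eqType) (s : seq I) (F : I -> set T) (f : T -> \bar R) :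
  (forall i, measurable (F i)) -> uniq s -> trivIset [set` s] F ->
  measurable_fun setT f -> (forall x, 0 <= f x) ->
  \sum_(i <- s) \int[mu]_(x in F i) f x <= \int[mu]_x f x.
Proof.
move=> mF us tF mf f0; rewrite -ge0_integral_bigsetU//; last exact: measurable_funTS.
by apply: ge0_subset_integral => //; exact: bigsetU_measurable.
Qed.

(** [h] is [g] restricted to the set where it exceeds [n]. The constant part is harmless on small
    balls, so that a covering argument has to pay for [h] only. *)
Lemma integrable_le_cst_add (g : T -> \bar R) (e : R) :
  measurable_fun setT g -> (forall x, 0 <= g x) ->
  \int[mu]_x g x < +oo -> (0 < e)%R ->
  exists (n : nat) (h : T -> \bar R), [/\ measurable_fun setT h,
    forall x, 0 <= h x, forall x, g x <= n%:R%:E + h x & \int[mu]_x h x <= e%:E].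
Proof.
move=> mg g0 gfin e0.
have [//|n ne] := @integral_tail_small setT g e _ mg g0 gfin e0.
exists n, (g \_ [set x | n%:R%:E < g x]); split.
- have mgt : measurable [set x | n%:R%:E < g x].
    by rewrite -[X in measurable X]setTI; exact: emeasurable_fun_o_infty.
  exact: ((measurable_restrictT _ mgt).1 (measurable_funTS mg)).
- by move=> x; apply: erestrict_ge0 => y _.
- move=> x; rewrite patchE; case: ifPn => [_|/negP].
    by rewrite leeDr// lee_fin.
  by rewrite adde0 => nx; rewrite leNgt; apply/negP => /mem_set.
- by rewrite -integral_mkcond; rewrite setTI in ne.
Qed.

End integral_lemmas.

(** * Analysis on the real line *)

Section line.
Context {R : realType}.
Local Notation leb := (@lebesgue_measure R).

Lemma lebesgue_measure_shift (s : R) (A : set R) : measurable A ->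
  pushforward leb (+%R s : measurableTypeR R -> measurableTypeR R) A = leb A.
Proof.
have ms : measurable_fun setT (+%R s : measurableTypeR R -> measurableTypeR R).
  by apply: (@measurable_funD _ _ R setT (cst s) idfun) => //; exact: measurable_id.
move=> mA; apply/esym/lebesgue_measure_unique => //= _ [[a b]] _ <-.
rewrite /pushforward.
have -> : +%R s @^-1` [set` `]a, b]] = [set` `](a - s)%R, (b - s)%R]].
  by apply/seteqP; split=> x; rewrite /= !in_itv/= ltrBlDl lerBrDl.
rewrite !lebesgue_measure_itv/= !lte_fin ltrD2r; case: ifPn => // _.
by rewrite -!EFinB; congr EFin; lra.
Qed.

Lemma ge0_integral_shift (f : R -> \bar R) (s t : R) :
  measurable_fun `[s, t] f -> (forall x, 0 <= f x) ->
  \int[leb]_(x in `[0%R, (t - s)%R]) f (s + x)%R = \int[leb]_(x in `[s, t]) f x.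
Proof.
move=> mf f0; rewrite (_ : `[0%R, (t - s)%R]%classic =
    (+%R s : measurableTypeR R -> measurableTypeR R) @^-1` `[s, t]); last first.
  by apply/seteqP; split=> x; rewrite /= !in_itv/= lerDl lerBrDl.
have ms : measurable_fun setT (+%R s : measurableTypeR R -> measurableTypeR R).
  by apply: (@measurable_funD _ _ R setT (cst s) idfun) => //; exact: measurable_id.
transitivity (\int[pushforward leb
    (+%R s : measurableTypeR R -> measurableTypeR R)]_(x in `[s, t]) f x).
  have E := @ge0_integral_pushforward _ _ _ _ R _ ms leb `[s, t] f
    (measurable_itv _) mf (fun y _ => f0 y).
  by apply/esym; exact: E.
by apply: eq_measure_integral => //= A mA AS; exact/lebesgue_measure_shift.
Qed.

(* If [phi] vanishes somewhere, follow it from [a] to its first zero, resp. from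
   its last zero to [b]. *)
Lemma ge0_variation_restrict (a b : R) (phi : R -> R) (h : R -> \bar R) (S : set R) :
  (a <= b)%R -> measurable S -> measurable_fun `[a, b] h -> (forall x, 0 <= h x) ->
  \int[leb]_(x in `[a, b]) h x < +oo ->
  (forall s t, (a <= s)%R -> (s <= t)%R -> (t <= b)%R ->
     `|phi s - phi t|%:E <= \int[leb]_(x in `[s, t]) h x) ->
  (forall x, (a <= x <= b)%R -> (0 <= phi x)%R) ->
  (forall x, (a <= x <= b)%R -> (0 < phi x)%R -> S x) ->
  `|phi a - phi b|%:E <= \int[leb]_(x in `[a, b] `&` S) h x.
Proof.
move=> ab mS mh h0 hfin var phi0 phiS.
pose Z := [set z | (a <= z <= b)%R /\ phi z = 0%R].
have SubI (A B : set R) : measurable A -> measurable B -> A `<=` B -> B `<=` `[a, b] ->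
    \int[leb]_(x in A) h x <= \int[leb]_(x in B) h x.
  move=> mA mB AB Bab; apply: ge0_subset_integral => //.
  exact: measurable_funS mh.
have mabS : measurable (`[a, b] `&` S) by exact: measurableI.
have [[z0 Zz0]|noZ] := pselect (exists z, Z z); last first.
  apply: le_trans (var a b _ _ _) _ => //.
  apply: SubI => // x /=; rewrite in_itv/= => xab.
  split=> //; apply: phiS => //; rewrite lt_neqAle phi0// andbT eq_sym.
  by apply/eqP => px; apply: noZ; exists x.
(* Absolute continuity of the integral: short intervals carry little of [h]. *)
have small (e : R) : (0 < e)%R -> exists2 del : R, (0 < del)%R &
    forall s t, (a <= s)%R -> (s <= t)%R -> (t <= b)%R -> (t - s < del)%R ->
    \int[leb]_(x in `[s, t]) h x <= e%:E.
  move=> e0; have e20 : (0 < e / 2)%R by rewrite divr_gt0.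
  have [//|n nP] := @integral_abs_continuous _ _ R leb _ _ (e / 2) _ mh h0 hfin e20.
  have {}nP s t : (a <= s)%R -> (t <= b)%R -> \int[leb]_(x in `[s, t]) h x <=
      n%:R%:E * leb `[s, t] + (e / 2)%:E.
    by move=> as_ tb; apply: nP => //; apply: subset_itvScc.
  exists (e / 2 / n.+1%:R)%R => [|s t as_ st tb tsd]; first by rewrite divr_gt0.
  apply: le_trans (nP s t _ _) _ => //.
  rewrite lebesgue_measure_itv/= lte_fin [X in _ <= X%:E](splitr e) EFinD leeD2r//.
  case: ifPn => _; last by rewrite mule0 lee_fin ltW.
  rewrite -EFinB -EFinM lee_fin.
  rewrite (@le_trans _ _ (n.+1%:R * (t - s))%R)// ?ler_wpM2r ?subr_ge0 ?ler_nat//.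
  by rewrite mulrC -ler_pdivlMr// ltW.
have infZ : has_inf Z.
  by split; [exists z0|exists a => z [/andP[]]].
have supZ : has_sup Z.
  by split; [exists z0|exists b => z [/andP[]]].
(* The infimum and the supremum of [Z] are not shown to be zeros of [phi]. A zero within [del] of
   them is used instead, and the interval [[y, y']] between the two, which may contain further
   zeros, costs at most [e]. *)
have cover (e : R) : (0 < e)%R -> exists2 del : R, (0 < del)%R & forall s t y y',
    (a <= s)%R -> (t <= b)%R -> (a <= y)%R -> (y <= y')%R -> (y' <= b)%R ->
    (y' - y < del)%R ->
    (forall w, (s <= w <= t)%R -> ~ (y <= w <= y')%R -> ~ Z w) ->
    \int[leb]_(x in `[s, t]) h x <= \int[leb]_(x in `[a, b] `&` S) h x + e%:E.
  move=> /small[del del0 delP]; exists del => // s t y y' as_ tb ay yy' y'b dy nZ.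
  apply: (@le_trans _ _ (\int[leb]_(w in (`[a, b] `&` S) `|` `[y, y']) h w)).
    apply: SubI => //.
    - by apply: measurableU.
    - move=> w; rewrite /= !in_itv/= => /andP[sw wt].
      have [|nw] := pselect (y <= w <= y')%R; [by right|left].
      have wab : (a <= w <= b)%R by rewrite (le_trans as_)// (le_trans wt).
      split=> //; apply: phiS => //; rewrite lt_neqAle phi0// andbT eq_sym.
      by apply/eqP => px; apply: (nZ w) => //; rewrite sw.
    - move=> w [[]//|]; rewrite /= !in_itv/= => /andP[yw wz].
      by rewrite (le_trans ay)// (le_trans wz).
  rewrite (le_trans (ge0_integral_setU_le _ _ _ _ _))//.
  - apply: measurable_funS mh => // w [[]//|]; rewrite /= !in_itv/= => /andP[yw wz].
    by rewrite (le_trans ay)// (le_trans wz).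
  - by apply: leeD2l; apply: delP.
have first : (phi a)%:E <= \int[leb]_(x in `[a, b] `&` S) h x.
  apply/lee_addgt0Pr => e e0; have [del del0 delP] := cover e e0.
  have [z Zz zd] := inf_adherent del0 infZ.
  have [/andP[az zb] phiz] := Zz.
  have ainf : (a <= inf Z)%R by apply: lb_le_inf => [|w [/andP[]]//]; exists z0.
  have infz : (inf Z <= z)%R by apply: ge_inf => //; exact: infZ.2.
  have := var a z (lexx a) az zb; rewrite phiz subr0 ger0_norm ?phi0 ?lexx//.
  move=> /le_trans; apply; apply: (delP a z (inf Z) z) => //.
    by rewrite ltrBlDl.
  move=> w /andP[aw wz] nw Zw; apply: nw; rewrite wz andbT.
  by apply: ge_inf => //; exact: infZ.2.
have last : (phi b)%:E <= \int[leb]_(x in `[a, b] `&` S) h x.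
  apply/lee_addgt0Pr => e e0; have [del del0 delP] := cover e e0.
  have [z Zz zd] := sup_adherent del0 supZ.
  have [/andP[az zb] phiz] := Zz.
  have supb : (sup Z <= b)%R by apply: ge_sup => [|w [/andP[]]//]; exists z0.
  have zsup : (z <= sup Z)%R by apply: ub_le_sup => //; exact: supZ.2.
  have := var z b az zb (lexx b); rewrite phiz sub0r normrN ger0_norm ?phi0 ?lexx ?ab//.
  move=> /le_trans; apply; apply: (delP z b z (sup Z)) => //.
    by rewrite ltrBlDl -ltrBlDr.
  move=> w /andP[aw wz] nw Zw; apply: nw; rewrite aw.
  by apply: ub_le_sup => //; exact: supZ.2.
have pa : (0 <= phi a)%R by rewrite phi0// lexx.
have pb : (0 <= phi b)%R by rewrite phi0// lexx ab.
(* Both values being nonnegative, their difference is at most the larger one. *)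
have [pab|pba] := leP (phi a) (phi b).
  by apply: le_trans last; rewrite lee_fin ler0_norm ?subr_le0// opprB lerBlDr lerDl.
  by apply: le_trans first; rewrite lee_fin ger0_norm ?subr_ge0 ?(ltW pba)// lerBlDr lerDl.
Qed.

End line.

(* Otherwise [Phi] grows with slope more than [M] to the right of every point of
   [[a, b[], hence from [a] to [b]. *)
Lemma good_level {R : realType} (Phi : R -> R) (a b M : R) : (a < b)%R ->
  {homo Phi : s t / (s <= t)%R} -> (Phi b - Phi a < M * (b - a))%R ->
  exists2 t : R, (a <= t < b)%R & forall eta, (0 < eta)%R ->
    exists h : R, (0 < h < eta)%R /\ (Phi (t + h) - Phi t <= M * h)%R.
Proof.
move=> ab ndPhi PhiM; apply: contrapT => bad.
have {}bad t : (a <= t < b)%R -> exists2 eta : R, (0 < eta)%R &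
    forall h, (0 < h < eta)%R -> (M * h < Phi (t + h) - Phi t)%R.
  move=> tab; apply: contrapT => neta; apply: bad; exists t => // eta eta0.
  apply: contrapT => nh; apply: neta; exists eta => // h hh.
  by rewrite ltNge; apply/negP => Ph; apply: nh; exists h.
pose S := [set t | (a <= t <= b)%R /\ (M * (t - a) <= Phi t - Phi a)%R].
have Sa : S a by split; [rewrite lexx ltW|rewrite !subrr mulr0].
have supS : has_sup S by split; [exists a|exists b => t [/andP[]]].
pose s := sup S.
have as_ : (a <= s)%R by apply: ub_le_sup => //; exact: supS.2.
have sb : (s <= b)%R by apply: ge_sup => [|t [/andP[]]//]; exists a.
have M0 : (0 < M)%R.
  have : (0 <= Phi b - Phi a)%R by rewrite subr_ge0 ndPhi// ltW.
  by move=> /le_lt_trans/(_ PhiM); rewrite pmulr_lgt0// subr_gt0.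
(* The supremum belongs to [S]: as [Phi] is nondecreasing, passing from a nearby [t] in [S] up to
   [s] loses at most [M * (s - t)]. *)
have Ss : (M * (s - a) <= Phi s - Phi a)%R.
  apply/ler_addgt0Pr => e e0; have eM : (0 < e / M)%R by rewrite divr_gt0.
  have [t St ts] := sup_adherent eM supS; have [_ tP] := St.
  have tles : (t <= s)%R by apply: ub_le_sup => //; exact: supS.2.
  have := ndPhi _ _ tles.
  have : (M * (s - t) <= e)%R by rewrite mulrC -ler_pdivlMr// lerBlDr -lerBlDl ltW.
  lra.
move: sb; rewrite le_eqVlt => /predU1P[sb|sb]; first by rewrite sb in Ss; lra.
(* If [s < b], the fast growth to the right of [s] puts [s + h] into [S]. Half of [eta] keeps the
   inequality strict, and [b - s] keeps the point in [[a, b]]. *)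
have [|eta eta0 etaP] := bad s; first by rewrite as_.
pose h := (Num.min (eta / 2) (b - s))%R.
have h0 : (0 < h)%R by rewrite lt_min divr_gt0//= subr_gt0.
have heta : (h < eta)%R by rewrite gt_min ltr_pdivrMr// ltr_pMr// ltr1n.
have hb : (h <= b - s)%R by rewrite ge_min lexx orbT.
have := etaP h; rewrite h0 heta => /(_ isT) hP.
have : S (s + h)%R by split; [apply/andP; split; lra|lra].
move=> /(ub_le_sup supS.2); rewrite -/s; lra.
Qed.

(** * Upper gradients *)

Section upper_gradients.
Context {R : realType} {X : completePMetricType R}.
Local Notation leb := (@lebesgue_measure R).
Local Notation borelT := (g_sigma_algebraType (@open X)).
Implicit Types (p q : X -> R) (g : X -> \bar R) (S : set X) (gamma : curve X).

Definition real_ug q g := upper_gradient (EFin \o q) g.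

Lemma metric_ball_open (x : X) (r : R) : open (ball x r).
Proof.
rewrite openE => y; rewrite ballEmdist/= => xy.
apply/nbhs_ballP; exists (r - mdist x y)%R; first by rewrite /= subr_gt0.
move=> z; rewrite ballEmdist/= => yz.
by rewrite (le_lt_trans (metric_triangle _ y _))// -ltrBrDl.
Qed.

Lemma borel_ball (x : X) (r : R) : measurable (ball x r : set borelT).
Proof. by apply: sub_sigma_algebra; exact: metric_ball_open. Qed.

Lemma measurable_fun_curve gamma :
  measurable_fun `[0%R, len gamma] (gamma : measurableTypeR R -> borelT).
Proof.
have /continuousP cg := @path_continuous _ _ gamma.
apply: (@measurability _ _ (measurableTypeR R) borelT `[0%R, len gamma]%classic
  gamma (@open X) erefl).
move=> _ [U oU <-]; apply: open_measurable_subspace => //.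
exact: cg.
Qed.

Lemma borel_fun_curve gamma g : borel_fun g ->
  measurable_fun `[0%R, len gamma] (g \o gamma).
Proof.
move=> mg; apply: (@measurable_comp _ _ _ _ borelT _ setT) => //.
exact: measurable_fun_curve.
Qed.

Lemma curve_integral_ge0 gamma g : (forall x, 0 <= g x) ->
  0 <= curve_integral gamma g.
Proof. by move=> g0; exact: integral_ge0. Qed.

Lemma curve_integral_le gamma g g' : borel_fun g -> borel_fun g' ->
  (forall x, 0 <= g x) -> (forall x, g x <= g' x) ->
  curve_integral gamma g <= curve_integral gamma g'.
Proof.
move=> mg mg' g0 gg'; apply: ge0_le_integral => //.
- exact: borel_fun_curve.
- exact: borel_fun_curve.
Qed.

Lemma real_ug_alongE q g gamma : upper_gradient_along (EFin \o q) g gamma =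
  (`|q (gamma 0%R) - q (gamma (len gamma))|%:E <= curve_integral gamma g) :> Prop.
Proof. by []. Qed.

Lemma real_ug_along q g gamma : real_ug q g ->
  `|q (gamma 0%R) - q (gamma (len gamma))|%:E <= curve_integral gamma g.
Proof. by case=> _ _ /(_ gamma). Qed.

(** The form needed by [ge0_variation_restrict], which follows [q] along a part of [gamma]. *)
Lemma real_ug_arc q g gamma (s t : R) : real_ug q g ->
  (0 <= s)%R -> (s <= t)%R -> (t <= len gamma)%R ->
  `|q (gamma s) - q (gamma t)|%:E <= \int[leb]_(x in `[s, t]) g (gamma x).
Proof.
move=> qg s0 st tl; have st0 : (0 <= s <= t)%R by rewrite s0.
have [eta leneta etaE] := subcurve st0 tl.
have [g0 mg _] := qg.
have := real_ug_along eta qg; rewrite leneta !etaE addr0 subrKC => /le_trans; apply.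
rewrite /curve_integral leneta.
under eq_integral do rewrite etaE.
rewrite (@ge0_integral_shift _ (g \o gamma))//; last by move=> x; exact: g0.
apply: measurable_funS (borel_fun_curve mg) => //.
by apply: subset_itvScc.
Qed.

(* The term [G'] takes care of the curves along which [G] is not integrable. *)
Lemma real_ug_restrict q G G' S : real_ug q G -> (forall x, 0 <= q x)%R ->
  measurable (S : set borelT) -> (forall x, (0 < q x)%R -> S x) ->
  borel_fun G' -> (forall x, 0 <= G' x) ->
  (forall gamma, curve_integral gamma G' < +oo -> curve_integral gamma G < +oo) ->
  real_ug q (fun x => (G \_ S) x + G' x).
Proof.
move=> qG q0 mS qS mG' G'0 fin; have [G0 mG _] := qG.
have mGS : borel_fun (G \_ S).
  exact: ((@measurable_restrictT _ _ borelT _ S G mS).1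
    (@measurable_funTS _ _ borelT _ S _ mG)).
have GS0 x : 0 <= (G \_ S) x by apply: erestrict_ge0 => y _.
split.
- by move=> x; rewrite adde_ge0.
- exact: emeasurable_funD.
move=> gamma; rewrite real_ug_alongE.
have [Gfin|] := boolP (curve_integral gamma G' < +oo); last first.
  rewrite -leNgt leye_eq => /eqP G'y.
  have : curve_integral gamma G' <= curve_integral gamma (fun x => (G \_ S) x + G' x).
    apply: curve_integral_le => //; first exact: emeasurable_funD.
    by move=> x; rewrite leeDr.
  by rewrite G'y leye_eq => /eqP ->; rewrite leey.
apply: (@le_trans _ _ (curve_integral gamma (G \_ S))); last first.
  apply: curve_integral_le => //; first exact: emeasurable_funD.
  by move=> x; rewrite leeDl.
pose S' := `[0%R, len gamma]%classic `&` gamma @^-1` S.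
have mS' : measurable S' := @measurable_fun_curve gamma (measurable_itv _) _ mS.
have := @ge0_variation_restrict R 0 (len gamma) (q \o gamma) (G \o gamma) S'.
have -> : curve_integral gamma (G \_ S) =
    \int[leb]_(x in `[0%R, len gamma] `&` S') (G \o gamma) x.
  rewrite setIA setIid integral_mkcondr.
  apply: eq_integral => x _; rewrite !patchE /=.
  by rewrite (_ : (x \in gamma @^-1` S) = (gamma x \in S))//.
apply => //.
- exact: len_ge0.
- exact: borel_fun_curve.
- by move=> x; exact: G0.
- exact: fin.
- by move=> s t s0 st tl; exact: real_ug_arc.
- by move=> x _; exact: q0.
- by move=> x xl px /=; split; [rewrite /= in_itv|apply: qS].
Qed.

Lemma real_ug_le q g g' : real_ug q g -> borel_fun g' -> (forall x, g x <= g' x) ->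
  real_ug q g'.
Proof.
move=> qg mg' gg'; have [g0 mg H] := qg; split=> //.
  by move=> x; exact: le_trans (gg' x).
by move=> gamma; apply: le_trans (H gamma) _; exact: curve_integral_le.
Qed.

Lemma real_ug_compl q g : real_ug q g -> real_ug (fun x => 1 - q x)%R g.
Proof.
case=> g0 mg H; split => // gamma; have := H gamma; rewrite !real_ug_alongE.
by rewrite distrC opprD opprK addrACA subrr add0r addrC.
Qed.

Lemma real_ug_between q G G' S1 S2 : real_ug q G -> (forall x, 0 <= q x <= 1)%R ->
  measurable (S1 : set borelT) -> (forall x, (0 < q x)%R -> S1 x) ->
  measurable (S2 : set borelT) -> (forall x, (q x < 1)%R -> S2 x) ->
  borel_fun G' -> (forall x, 0 <= G' x) ->
  (forall gamma, curve_integral gamma G' < +oo -> curve_integral gamma G < +oo) ->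
  real_ug q (fun x => (G \_ (S1 `&` S2)) x + (G' x + G' x)).
Proof.
move=> qG q01 mS1 qS1 mS2 qS2 mG' G'0 fin.
have q0 x : (0 <= q x)%R by have /andP[] := q01 x.
have [G0 mG _] := qG.
have u1 := real_ug_restrict qG q0 mS1 qS1 mG' G'0 fin.
have [H0 mH _] := u1.
have mGI S : measurable (S : set borelT) -> borel_fun (G \_ S).
  by move=> mS; exact: ((@measurable_restrictT _ _ borelT _ S G mS).1
    (@measurable_funTS _ _ borelT _ S _ mG)).
have GS0 S x : 0 <= (G \_ S) x by apply: erestrict_ge0 => y _.
have fin1 gamma : curve_integral gamma G' < +oo ->
    curve_integral gamma (fun x => (G \_ S1) x + G' x) < +oo.
  move=> G'fin; apply: (@le_lt_trans _ _ (curve_integral gamma (fun x => G x + G' x))).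
    apply: curve_integral_le => //; first exact: emeasurable_funD.
    by move=> x; rewrite leeD2r// patchE; case: ifPn.
  rewrite /curve_integral ge0_integralD//; [|exact: borel_fun_curve..].
  by rewrite lte_add_pinfty// fin.
have u2 := real_ug_restrict (real_ug_compl u1) _ mS2 _ mG' G'0 fin1.
have /u2 {}u2 x : (0 <= 1 - q x)%R by rewrite subr_ge0; have /andP[] := q01 x.
have /u2 {}u2 x : (0 < 1 - q x)%R -> S2 x by rewrite subr_gt0; exact: qS2.
have -> : q = (fun x => 1 - (1 - q x))%R by apply/funext => x; rewrite subKr.
apply: real_ug_compl; apply: real_ug_le u2 _ _.
  apply: emeasurable_funD; last exact: emeasurable_funD.
  by apply: mGI; exact: measurableI.
move=> x; rewrite addeA leeD2r// !patchE in_setI.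
case: (x \in S1); case: (x \in S2) => //=; rewrite ?add0e ?adde0//.
Qed.

Lemma real_ug_lipschitz_comp p q g (k : R) : real_ug q g -> (0 <= k)%R ->
  (forall x y, `|p x - p y| <= k * `|q x - q y|)%R ->
  real_ug p (fun x => k%:E * g x).
Proof.
move=> qg k0 pq; have [g0 mg _] := qg.
split=> [x||gamma]; first by rewrite mule_ge0.
  exact: measurable_funeM.
rewrite real_ug_alongE /curve_integral.
rewrite ge0_integralZl//; last exact: borel_fun_curve.
apply: (@le_trans _ _ (k%:E * `|q (gamma 0%R) - q (gamma (len gamma))|%:E)).
  by rewrite -EFinM lee_fin.
by rewrite lee_wpmul2l// real_ug_along.
Qed.

Lemma real_ugD p q1 q2 g1 g2 : real_ug q1 g1 -> real_ug q2 g2 ->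
  (forall x y, `|p x - p y| <= `|q1 x - q1 y| + `|q2 x - q2 y|)%R ->
  real_ug p (fun x => g1 x + g2 x).
Proof.
move=> qg1 qg2 pq; have [g10 mg1 _] := qg1; have [g20 mg2 _] := qg2.
split=> [x||gamma]; first by rewrite adde_ge0.
  exact: emeasurable_funD.
rewrite real_ug_alongE /curve_integral.
rewrite ge0_integralD//; [|exact: borel_fun_curve..].
apply: (@le_trans _ _ (`|q1 (gamma 0%R) - q1 (gamma (len gamma))| +
   `|q2 (gamma 0%R) - q2 (gamma (len gamma))|)%:E); first by rewrite lee_fin.
by rewrite EFinD leeD// real_ug_along.
Qed.

(** Along any curve the sum dominates each [g k], hence it bounds all the increments of the [q k] at
    once. The second hypothesis is the property of a pointwise supremum that transfers such a bound
    to [p]. *)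
Lemma real_ug_sup p (q : nat -> X -> R) (g : nat -> X -> \bar R) :
  (forall k, real_ug (q k) (g k)) ->
  (forall x y c, (forall k, `|q k x - q k y| <= c)%R -> (`|p x - p y| <= c)%R) ->
  real_ug p (fun x => \sum_(k <oo) g k x).
Proof.
move=> qg pq.
have g0 k x : 0 <= g k x by case: (qg k).
have mg k : borel_fun (g k) by case: (qg k).
have mS : borel_fun (fun x => \sum_(k <oo) g k x).
  apply: (@ge0_emeasurable_sum _ borelT R setT g xpredT) => //.
  by move=> k _; exact: mg.
split=> // [x|gamma]; first exact: nneseries_ge0.
rewrite real_ug_alongE.
have H k : `|q k (gamma 0%R) - q k (gamma (len gamma))|%:E <=
    curve_integral gamma (fun x => \sum_(k <oo) g k x).
  apply: le_trans (real_ug_along gamma (qg k)) _.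
  apply: curve_integral_le => // x.
  rewrite (nneseriesD1 (n := k))//.
  by rewrite leeDl// nneseries_ge0.
move: H; have := @curve_integral_ge0 gamma (fun x => \sum_(k <oo) g k x).
move=> /(_ (fun x => nneseries_ge0 (fun k _ _ => g0 k x))).
case: curve_integral => [r _ H| _ _|//]; last by rewrite leey.
by rewrite lee_fin; apply: pq => k; rewrite -lee_fin.
Qed.

Lemma curve_integral_cst gamma (c : R) :
  curve_integral gamma (cst c%:E) = (c * len gamma)%:E.
Proof.
have lebE : leb `[0%R, len gamma] = (len gamma)%:E.
  rewrite lebesgue_measure_itv/= lte_fin; case: ltP => [l0|l0]; first by rewrite sube0.
  by have /eqP -> : len gamma == 0%R by rewrite eq_le l0 len_ge0.
transitivity (c%:E * leb `[0%R, len gamma]); last by rewrite lebE.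
exact: integral_cst.
Qed.

Lemma real_ug_lipschitz q (k : R) : (0 <= k)%R ->
  (forall x y, `|q x - q y| <= k * mdist x y)%R -> real_ug q (cst k%:E).
Proof.
move=> k0 qk; split=> [x||gamma]; first by rewrite lee_fin.
  exact: measurable_cst.
rewrite real_ug_alongE curve_integral_cst lee_fin.
rewrite (le_trans (qk _ _))// ler_wpM2l//.
rewrite (le_trans (@curve_mdist_le _ _ gamma 0 (len gamma) _ _))// ?subr0//.
by rewrite lexx len_ge0.
Qed.

End upper_gradients.

(** * Capacity *)

Section covering.
Context {R : realType} {X : completePMetricType R}.

(* Zorn's lemma applied to the disjoint subfamilies such that every ball meeting
   a member meets a member of at least half its radius. *)
Lemma vitali_cover_metric (S : set X) (rho : X -> R) (M : R) :
  (forall y, S y -> (0 < rho y <= M)%R) ->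
  exists J, [/\ J `<=` S, trivIset J (fun y => ball y (rho y)) &
    S `<=` \bigcup_(y in J) ball y (3 * rho y)].
Proof.
move=> rhoM; pose B y := ball y (rho y).
have Bself y : S y -> B y y by move=> /rhoM/andP[r0 _]; exact: ballxx.
pose meets (J : set X) x := exists2 j, J j & B x `&` B j !=set0.
pose P (J : set X) := [/\ J `<=` S, trivIset J B &
  forall x, S x -> meets J x ->
    exists j, [/\ J j, B x `&` B j !=set0 & (rho x <= 2 * rho j)%R]].
have [F FP tF|A [[AS tA hA] maxA]] := @Zorn_bigcup _ P.
  split.
  - by move=> x [J FJ Jx]; have [JS _ _] := FP _ FJ; exact: JS.
  - move=> x y [J FJ Jx] [K FK Ky].
    have [JK|KJ] := tF _ _ FJ FK.
    + have [_ tK _] := FP _ FK; apply: tK => //; exact: JK.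
    + have [_ tJ _] := FP _ FJ; apply: tJ => //; exact: KJ.
  - move=> x Sx [j [J FJ Jj] xj]; have [_ _ hJ] := FP _ FJ.
    have [|k [Jk xk rk]] := hJ x Sx; first by exists j.
    by exists k; split => //; exists J.
have all_meet x : S x -> meets A x.
  move=> Sx; apply: contrapT => nmx.
  (* Among the balls that meet no member of [A], one with at least half the supremal radius is added
     to [A]. A ball that meets the new member and no old one has radius at most [sup U], so the
     enlarged family keeps property [P], against maximality. *)
  pose U := [set rho y | y in [set y | S y /\ ~ meets A y]].
  have supU : has_sup U.
    split; first by exists (rho x), x.
    by exists M => _ [y [Sy _] <-]; have /andP[] := rhoM _ Sy.
  have rx0 : (0 < rho x)%R by case/andP: (rhoM _ Sx).
  have xU : (rho x <= sup U)%R by apply: ub_le_sup; [exact: supU.2|exists x].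
  have s0 : (0 < sup U)%R by exact: lt_le_trans xU.
  have [|_ [y [Sy nmy] <-] ylt] := @sup_adherent _ _ (sup U / 2) _ supU.
    by rewrite divr_gt0.
  have supy : (sup U <= 2 * rho y)%R by lra.
  apply: (maxA (A `|` [set y])).
    split; first exact: subsetUl.
    move=> /(_ y) /= Ay; apply: nmy; exists y; first by apply: Ay; right.
    by exists y; split; exact: Bself.
  split.
  - by move=> z [/AS//|->].
  - move=> a b [Aa|->] [Ab|->] ab //; first exact: tA.
    + by exfalso; apply: nmy; exists a => //; rewrite setIC.
    + by exfalso; apply: nmy; exists b.
  - move=> z Sz [j Aj zj].
    have [mz|nmz] := pselect (meets A z).
      by have [k [Ak zk rk]] := hA z Sz mz; exists k; split=> //; left.
    case: Aj => [Aj|jy]; first by exfalso; apply: nmz; exists j.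
    exists y; split; [by right|by rewrite -jy|].
    rewrite (le_trans _ supy)//; apply: ub_le_sup; first exact: supU.2.
    by exists z.
exists A; split=> // y Sy.
(* The centres are at distance less than [rho y + rho j], which is at most [3 * rho j]. *)
have [j [Aj [z [yz jz]] rj]] := hA y Sy (all_meet y Sy).
exists j => //; move: yz jz; rewrite /B !ballEmdist/= => yz jz.
have := metric_triangle j z y; rewrite (metric_sym z y); lra.
Qed.

(** At most [n.+1 * N] of the weights can exceed [n.+1^-1], so each [Jn n] is finite. *)
Lemma countable_bounded_sums (I : choiceType) (J : set I) (w : I -> R) (N : R) :
  (forall y, J y -> (0 < w y)%R) ->
  (forall s : seq I, uniq s -> {subset s <= J} -> (\sum_(y <- s) w y <= N)%R) ->
  countable J.
Proof.
move=> w0 sN; pose Jn (n : nat) := J `&` [set y | (n.+1%:R^-1 < w y)%R].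
have JE : J = \bigcup_n Jn n.
  apply/seteqP; split=> [y Jy|y [n _ []]//].
  have wy := w0 y Jy; exists (Num.truncn (w y)^-1) => //; split => //=.
  by rewrite invf_plt ?posrE ?ltr0n// truncnS_gt.
rewrite JE; apply: bigcup_countable => // n _; apply: finite_set_countable.
apply: contrapT => infJ.
have [B BJ cB] := infinite_set_fset (Num.truncn (n.+1%:R * N)).+1 infJ.
have bound : (\sum_(y <- enum_fset B) w y <= N)%R.
  by apply: sN; [exact: fset_uniq|by move=> y /BJ[Jy _]; exact: mem_set].
have : (\sum_(y <- enum_fset B) n.+1%:R^-1 <= \sum_(y <- enum_fset B) w y)%R.
  by rewrite !big_seq; apply: ler_sum => y /BJ[_ /ltW].
rewrite big_const_seq count_predT iter_addr_0 => /le_trans/(_ bound).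
rewrite -[X in (X <= _)%R]mulr_natr [X in (X <= _)%R]mulrC ler_pdivrMr ?ltr0n//.
rewrite leNgt => /negP; apply.
rewrite mulrC; apply: lt_le_trans (truncnS_gt _) _.
by rewrite ler_nat.
Qed.

End covering.

(** * Truncations and cutoff functions *)

Section clamp.
Context {R : realType}.

Definition clamp (r : R) : R := Num.min (Num.max r 0%R) 1%R.

Lemma clamp_itv r : (0 <= clamp r <= 1)%R.
Proof. by rewrite /clamp le_min ler01 le_max lexx orbT ge_min lexx orbT. Qed.

Lemma clamp_lip r s : (`|clamp r - clamp s| <= `|r - s|)%R.
Proof.
rewrite /clamp /Order.min /Order.max; do ! case: ifPn; rewrite -?leNgt => *;
  rewrite ler_norml; have := ler_norm (r - s)%R; have := ler_norm (s - r)%R;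
  rewrite (distrC s); lra.
Qed.

Lemma clamp1 r : (1 <= r)%R -> clamp r = 1%R.
Proof. by move=> r1; rewrite /clamp; apply/min_idPr; rewrite le_max r1. Qed.

Lemma clamp0 r : (r <= 0)%R -> clamp r = 0%R.
Proof.
by move=> r0; rewrite /clamp (max_idPr r0); apply/min_idPl; exact: ler01.
Qed.

Lemma clamp_gt0 r : (0 < clamp r)%R -> (0 < r)%R.
Proof. by rewrite !ltNge; apply: contra => /clamp0 ->. Qed.

Lemma clamp_lt1 r : (clamp r < 1)%R -> (r < 1)%R.
Proof. by rewrite !ltNge; apply: contra => /clamp1 ->. Qed.

Lemma measurable_clamp d (T : measurableType d) (f : T -> R) :
  measurable_fun setT f -> measurable_fun setT (fun x => clamp (f x)).
Proof. by move=> mf; apply: measurable_minr => //; exact: measurable_maxr. Qed.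

(** Turns the extended real-valued competitors for [cap1] into real-valued ones; [fine] loses
    nothing, as its argument lies in [[0, 1]]. *)
Definition eclamp (x : \bar R) : R := fine (mine (maxe x 0) 1).

Lemma eclamp_EFin (r : R) : eclamp r%:E = clamp r.
Proof. by rewrite /eclamp -EFin_max -EFin_min. Qed.

Lemma eclamp_itv x : (0 <= eclamp x <= 1)%R.
Proof.
case: x => [r||].
- by rewrite eclamp_EFin clamp_itv.
- by rewrite /eclamp maxye minye /= ler01 lexx.
- by rewrite /eclamp maxNye -[0]/(0%R%:E) -EFin_min /= min_l// lexx ler01.
Qed.

(** Since [+oo - +oo = -oo], the right-hand side is [+oo] as soon as one argument is infinite. *)
Lemma eclamp_lip x y : `|eclamp x - eclamp y|%:E <= `|x - y|.
Proof.
case: x y => [r||] [s||] //=; rewrite ?leey//.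
by rewrite !eclamp_EFin lee_fin clamp_lip.
Qed.

Lemma eclamp1 x : 1 <= x -> eclamp x = 1%R.
Proof.
move=> x1; rewrite /eclamp (_ : mine _ _ = 1)//; apply/min_idPr.
by rewrite le_max x1.
Qed.

End clamp.

Section cutoff.
Context {R : realType} {X : completePMetricType R}.

Definition cutoff (y : X) (a b : R) (x : X) : R :=
  clamp ((b - mdist y x) / (b - a)).

Lemma cutoff_ug (y : X) (a b : R) : (a < b)%R ->
  real_ug (cutoff y a b) (cst (b - a)^-1%:E).
Proof.
move=> ab; have ba0 : (0 < b - a)%R by rewrite subr_gt0.
apply: real_ug_lipschitz; first by rewrite invr_ge0 ltW.
move=> x z; apply: le_trans (clamp_lip _ _) _.
rewrite -mulrBl normrM mulrC (@ger0_norm _ (b - a)^-1) ?invr_ge0 ?(ltW ba0)//.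
rewrite ler_pM2l ?invr_gt0// ler_norml.
have := metric_triangle y x z; have := metric_triangle y z x.
rewrite (metric_sym z x); lra.
Qed.

Lemma cutoff1 (y x : X) (a b : R) : (a < b)%R -> (mdist y x <= a)%R ->
  cutoff y a b x = 1%R.
Proof. by move=> ab yx; apply: clamp1; rewrite ler_pdivlMr ?subr_gt0//; lra. Qed.

Lemma cutoff0 (y x : X) (a b : R) : (a < b)%R -> (b <= mdist y x)%R ->
  cutoff y a b x = 0%R.
Proof.
by move=> ab yx; apply: clamp0; rewrite ler_pdivrMr ?subr_gt0// mul0r subr_le0.
Qed.

Lemma cutoff_gt0 (y x : X) (a b : R) : (a < b)%R -> (0 < cutoff y a b x)%R ->
  ball y b x.
Proof.
move=> ab; rewrite ballEmdist/= ltNge => + ; rewrite ltNge; apply: contra.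
by move=> /(cutoff0 ab) ->.
Qed.

End cutoff.

(** * Test functions and subadditivity of the capacity *)

Section capacity.
Context {R : realType} {X : completePMetricType R}.
Variable mu : {outer_measure set X -> \bar R}.
Hypothesis hreg : borel_regular mu.
Local Notation borelT := (g_sigma_algebraType (@open X)).
Local Notation T := (caratheodory_type mu).
Local Notation m := (cara_measure mu).
Implicit Types (p q : X -> R) (g : X -> \bar R) (A D S : set X).

Lemma borel_cara (S : set X) :
  measurable (S : set borelT) -> measurable (S : set T).
Proof. exact: hreg.1. Qed.

Lemma ball_cara (x : X) (r : R) : measurable (ball x r : set T).
Proof. by apply: borel_cara; exact: borel_ball. Qed.

Lemma borel_fun_cara g : borel_fun g -> measurable_fun setT (g : T -> \bar R).
Proof.
by move=> mg _ B mB; apply: borel_cara; exact: (mg measurableT B mB).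
Qed.

Lemma measurable_mdist (y : X) : measurable_fun setT (mdist y : T -> R).
Proof.
apply: (measurability _ (RGenInftyO.measurableE R)) => _ [_ [r ->] <-].
rewrite setTI (_ : _ @^-1` _ = ball y r); first exact: ball_cara.
by rewrite ballEmdist; apply/seteqP; split=> x /=; rewrite in_itv.
Qed.

Lemma measurable_cutoff (y : X) (a b : R) :
  measurable_fun setT (cutoff y a b : T -> R).
Proof.
apply: (@measurable_clamp _ _ T); apply: (@measurable_funM _ T) => //.
by apply: (@measurable_funB _ T) => //; exact: measurable_mdist.
Qed.

(** Level sets of test functions are only Caratheodory-measurable, whereas a restricted upper
    gradient must be Borel. Regularity gives a Borel hull [B] of the part of [E] in [D]; adding the
    complement of [D] makes it contain all of [E], and the excess in [D] is null because the
    measures are finite. *)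
Lemma borel_hull (E D : set X) : measurable (E : set T) ->
  measurable (D : set borelT) -> mu D < +oo ->
  exists S : set X, [/\ measurable (S : set borelT), E `<=` S &
    mu (D `&` (S `\` E)) = 0].
Proof.
move=> mE mD Dfin; have mD' := borel_cara mD.
have mED : measurable (E `&` D : set T) by exact: measurableI.
have [B [mB EB muB]] := hreg.2 (E `&` D).
have mB' : measurable (B : set T) := hreg.1 B mB.
exists (B `|` ~` D); split.
- by apply: measurableU => //; exact: measurableC.
- by move=> x Ex; have [Dx|nDx] := pselect (D x); [left; exact: EB|right].
- apply/eqP; rewrite eq_le outer_measure_ge0 andbT.
  have EDfin : mu (E `&` D) < +oo by rewrite (le_lt_trans _ Dfin)// le_outer_measure.
  have Bfin : mu B < +oo by rewrite muB.
  have : m (B `\` (E `&` D)) = 0.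
    rewrite (@measureD _ _ _ m)//.
    have -> : B `&` (E `&` D) = E `&` D by apply/setIidPr.
    transitivity (mu (E `&` D) - mu (E `&` D)); first by congr (_ - _); exact: muB.
    by rewrite subee// ge0_fin_numE ?outer_measure_ge0.
  move=> <-; apply: le_outer_measure => x [Dx [[Bx|//] nEx]]; split=> //.
  by case.
Qed.

(** Membership in [N11] is left out: it is automatic if [D] has finite measure and [g] has finite
    integral. *)
Definition test_fun A D q g := [/\ measurable_fun setT (q : T -> R),
  forall x, (0 <= q x <= 1)%R, forall x, A x -> q x = 1%R,
  forall x, ~ D x -> q x = 0%R & real_ug q g].

Lemma cap1_le A D q g : measurable (D : set borelT) -> mu D < +oo ->
  test_fun A D q g -> cap1 mu A D <= \int[m]_x g x.
Proof.
move=> mD Dfin [mq q01 qA qD qg]; have [g0 mg ug] := qg.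
have [gy|gfin] := eqVneq (\int[m]_x g x) +oo; first by rewrite gy leey.
apply: ereal_inf_lbound; exists (EFin \o q), g; split => //.
- split=> //; split; first exact/measurable_EFinP.
  rewrite /N11_norm lte_add_pinfty//.
    rewrite (le_lt_trans _ Dfin)//.
    apply: (@le_trans _ _ (\int[m]_x (\1_D x)%:E)).
      apply: ge0_le_integral => //.
      - by apply: measurableT_comp => //; exact/measurable_EFinP.
      - apply/measurable_EFinP; apply: measurable_indic; exact: borel_cara.
      - move=> x _; rewrite lee_fin indicE; have /andP[q0 q1] := q01 x.
        have [xD|] := boolP (x \in D); first by rewrite ger0_norm.
        by rewrite notin_setE => /qD ->; rewrite normr0.
    by rewrite integral_indic ?setIT//; exact: borel_cara.
  apply: (@le_lt_trans _ _ (\int[m]_x g x)); last by rewrite ltey.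
  apply: ereal_inf_lbound; exists g => //; split=> //; first exact: borel_fun_cara.
  exists set0 => //; exists (cst 0); split => //.
  - exact: measurable_cst.
  - exact: integrable0.
- by move=> x /qA /= ->.
- by move=> x /qD /= ->.
Qed.

Lemma cap1_lt A D (c : \bar R) : cap1 mu A D < c ->
  exists q g, test_fun A D q g /\ \int[m]_x g x < c.
Proof.
move=> /ereal_inf_lt[_ [u [g [[[mu_ uN] ug] uA uD ->]]] gc].
exists (eclamp \o u), g; split => //; split.
- have mc : measurable_fun setT (fun x : T => mine (maxe (u x) 0) 1).
    by apply: measurable_mine => //; apply: measurable_maxe.
  exact: (measurableT_comp (fine_measurable measurableT) mc).
- by move=> x; exact: eclamp_itv.
- by move=> x /uA; exact: eclamp1.
- by move=> x /uD /= ->; rewrite eclamp_EFin clamp0.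
- have [g0 mg H] := ug; split => // gamma; apply: le_trans (H gamma).
  exact: eclamp_lip.
Qed.

Lemma cap1_ge0 A D : 0 <= cap1 mu A D.
Proof.
apply: le_ereal_inf_tmp => _ [u [g [[_ [g0 _ _]] _ _ ->]]].
exact: integral_ge0.
Qed.

Lemma cap1_mono A B D : A `<=` B -> cap1 mu A D <= cap1 mu B D.
Proof.
move=> AB; apply: ereal_inf_le_tmp => _ [u [g [ug uB uD ->]]].
by exists u, g; split => // x /AB; exact: uB.
Qed.

(** The supremum of near optimal test functions is a test function for the union, and the sum of
    their gradients is an upper gradient of it by [real_ug_sup]. The errors [e / 2 ^ k.+1] add up to
    [e]. *)
Lemma cap1_bigcup (A : nat -> set X) D : measurable (D : set borelT) ->
  mu D < +oo -> cap1 mu (\bigcup_k A k) D <= \sum_(k <oo) cap1 mu (A k) D.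
Proof.
move=> mD Dfin.
have [Sy|Sfin] := eqVneq (\sum_(k <oo) cap1 mu (A k) D) +oo; first by rewrite Sy leey.
have capfin k : cap1 mu (A k) D \is a fin_num.
  rewrite ge0_fin_numE ?cap1_ge0//.
  rewrite (@le_lt_trans _ _ (\sum_(k <oo) cap1 mu (A k) D))//; last by rewrite ltey.
  rewrite (nneseriesD1 (n := k))//; last by move=> *; exact: cap1_ge0.
  by rewrite leeDl// nneseries_ge0// => *; exact: cap1_ge0.
apply/lee_addgt0Pr => e e0.
have /choice[qg qgP] : forall k, exists qg : (X -> R) * (X -> \bar R),
    test_fun (A k) D qg.1 qg.2 /\
    \int[m]_x qg.2 x < cap1 mu (A k) D + (e / (2 ^ k.+1)%:R)%:E.
  move=> k; have [q [g [qg gc]]] : exists q g, test_fun (A k) D q g /\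
      \int[m]_x g x < cap1 mu (A k) D + (e / (2 ^ k.+1)%:R)%:E.
    apply: cap1_lt; rewrite lteDl// lte_fin divr_gt0// ltr0n expn_gt0//.
  by exists (q, g).
pose q k := (qg k).1; pose g k := (qg k).2.
have qb x k : (0 <= q k x <= 1)%R by have [[_ + _ _ _] _] := qgP k; apply.
have qA k x : A k x -> q k x = 1%R by have [[_ _ + _ _] _] := qgP k; apply.
have qD k x : ~ D x -> q k x = 0%R by have [[_ _ _ + _] _] := qgP k; apply.
have g0 k x : 0 <= g k x by have [[_ _ _ _ [+ _ _]] _] := qgP k; apply.
have mg k : borel_fun (g k) by have [[_ _ _ _ [_ + _]] _] := qgP k.
have qub x : has_ubound (range (q ^~ x)).
  by exists 1%R => _ [k _ <-]; have /andP[] := qb x k.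
pose p x := sup (range (q ^~ x)).
have qp k x : (q k x <= p x)%R by apply: ub_le_sup => //; exists k.
have pc x c : (forall k, q k x <= c)%R -> (p x <= c)%R.
  by move=> qc; apply: ge_sup => [|_ [k _ <-]//]; exists (q 0%N x), 0%N.
have pT : test_fun (\bigcup_k A k) D p (fun x => \sum_(k <oo) g k x).
  split.
  - have -> : p = (fun x => sups (q ^~ x) 0%N).
      apply/funext => x; congr sup.
      by apply/seteqP; split=> [_ [k _ <-]|_ [k _ <-]]; exists k.
    apply: (@measurable_fun_sups _ T) => // k.
    by have [[]] := qgP k.
  - move=> x; rewrite (le_trans _ (qp 0%N x)) ?pc// => [k|].
      by have /andP[] := qb x k.
    by have /andP[] := qb x 0%N.
  - move=> x [k _ Akx]; apply/eqP; rewrite eq_le pc => [|k']; last first.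
      by have /andP[] := qb x k'.
    by rewrite (le_trans _ (qp k x))// qA.
  - move=> x nDx; apply/eqP; rewrite eq_le pc => [|k]; last first.
      by rewrite qD.
    by rewrite (le_trans _ (qp 0%N x))//; have /andP[] := qb x 0%N.
  - apply: (@real_ug_sup _ _ _ q) => [k|x y c H]; first by have [[]] := qgP k.
    have H' z w : (forall k, `|q k z - q k w| <= c)%R -> (p z - p w <= c)%R.
      move=> Hzw; rewrite lerBlDl; apply: pc => k.
      rewrite -lerBlDl (le_trans (lerB (lexx _) (qp k w)))//.
      by rewrite (le_trans (ler_norm _)).
    rewrite ler_norml lerNl opprB !H'// => k; by rewrite distrC.
apply: le_trans (cap1_le mD Dfin pT) _.
rewrite integral_nneseries//; last by move=> k; exact: borel_fun_cara.
apply: le_trans (epsilon_trick _ _ (ltW e0)); last by move=> k; exact: cap1_ge0.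
apply: lee_nneseries => k _; last by apply: ltW; have [] := qgP k.
by move=> _; apply: integral_ge0 => x _; exact: g0.
Qed.

Lemma cap1_set0 D : measurable (D : set borelT) -> mu D < +oo ->
  cap1 mu set0 D = 0.
Proof.
move=> mD Dfin; apply/eqP; rewrite eq_le cap1_ge0 andbT.
rewrite (le_trans (@cap1_le set0 D (cst 0%R) (cst 0) mD Dfin _))//.
  split=> //.
  - by move=> x; rewrite lexx ler01.
  - apply: (@real_ug_lipschitz _ _ _ 0%R) => // x y.
    by rewrite subrr normr0 mul0r.
by rewrite integral0.
Qed.

Lemma cap1U A B D : measurable (D : set borelT) -> mu D < +oo ->
  cap1 mu (A `|` B) D <= cap1 mu A D + cap1 mu B D.
Proof.
move=> mD Dfin; rewrite -bigcup2E (le_trans (cap1_bigcup _ mD Dfin))//.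
rewrite (nneseries_split 0%N 2%N)/=; last by move=> *; exact: cap1_ge0.
rewrite add0n big_nat_recl// big_nat1 /= eseries0 ?adde0//.
by move=> [|[|k]] // _ _; exact: cap1_set0.
Qed.

(** The test function is the cutoff between [rho] and [2 * rho]. Its constant gradient has finite
    integral along every curve, so it can be restricted to the larger ball with error term 0. *)
Lemma cap1_ball (y : X) (rho : R) D : (0 < rho)%R ->
  measurable (D : set borelT) -> mu D < +oo -> ball y (2 * rho) `<=` D ->
  cap1 mu (ball y rho) D <= rho^-1%:E * mu (ball y (2 * rho)).
Proof.
move=> rho0 mD Dfin yD.
have ab : (rho < 2 * rho)%R by lra.
pose eta := cutoff y rho (2 * rho).
have etaE : (2 * rho - rho = rho)%R by lra.
have etaL : real_ug eta (cst rho^-1%:E) by have := cutoff_ug y ab; rewrite etaE.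
have eta01 x : (0 <= eta x <= 1)%R by exact: clamp_itv.
have eta0 x : (0 <= eta x)%R by have /andP[] := eta01 x.
have etaS x : (0 < eta x)%R -> ball y (2 * rho) x by exact: cutoff_gt0.
have cfin gamma : curve_integral gamma (cst 0 : X -> \bar R) < +oo ->
    curve_integral gamma (cst rho^-1%:E : X -> \bar R) < +oo.
  by move=> _; rewrite curve_integral_cst ltry.
have etaug := real_ug_restrict etaL eta0 (borel_ball y (2 * rho)) etaS
  (measurable_cst 0) (fun=> lexx 0) cfin.
have etaT : test_fun (ball y rho) D eta
    (fun x => (cst rho^-1%:E \_ (ball y (2 * rho))) x + cst 0 x).
  split=> //.
  - exact: measurable_cutoff.
  - by move=> x; rewrite ballEmdist/= => yx; apply: cutoff1 => //; exact: ltW.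
  - move=> x nDx; apply/eqP; rewrite eq_le eta0 andbT leNgt; apply/negP => /etaS/yD.
    exact: nDx.
apply: le_trans (cap1_le mD Dfin etaT) _.
under eq_integral do rewrite adde0.
rewrite -integral_mkcond integral_cst//; exact: ball_cara.
Qed.

Lemma level_set_measurable (q : X -> R) (t : R) : measurable_fun setT (q : T -> R) ->
  measurable ([set y | (t < q y)%R] : set T).
Proof.
move=> mq; have := mq measurableT `]t, +oo[%classic (measurable_itv _).
by rewrite setTI; congr measurable; apply/seteqP; split => y /=; rewrite in_itv/= andbT.
Qed.

(** The truncation varies only where [t < q < t + h]. The set is stated with [q <= t + h], so that
    its energy is a difference of values of the distribution function of the energy. *)
Lemma truncation_ug (q : X -> R) (g : X -> \bar R) (D : set X) (t h : R) :
  measurable_fun setT (q : T -> R) -> measurable (D : set borelT) -> mu D < +oo ->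
  (forall y, (t < q y)%R -> D y) -> real_ug q g -> (0 < h)%R ->
  exists2 g', real_ug (fun y => clamp ((q y - t) / h)) g' &
    \int[m]_y g' y <= h^-1%:E * \int[m]_(y in [set y | (t < q y <= t + h)%R]) g y
      + (\int[m]_y g y + \int[m]_y g y).
Proof.
move=> mq mD Dfin qD qg h0; have [g0 mg _] := qg.
have mgT := borel_fun_cara mg.
have hV0 : (0 <= h^-1)%R by rewrite invr_ge0 ltW.
pose E1 := [set y | (t < q y)%R]; pose E2 := [set y | (q y < t + h)%R].
have mE1 : measurable (E1 : set T).
  exact: level_set_measurable.
have mE2 : measurable (E2 : set T).
  have := mq measurableT `]-oo, (t + h)%R[%classic (measurable_itv _).
  by rewrite setTI; congr measurable; apply/seteqP; split => y /=; rewrite in_itv/=.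
have mE3 : measurable ([set y | (t < q y <= t + h)%R] : set T).
  have := mq measurableT `]t, (t + h)%R]%classic (measurable_itv _).
  by rewrite setTI; congr measurable; apply/seteqP; split => y /=; rewrite in_itv/=.
have [S1 [mS1 ES1 N1]] := borel_hull mE1 mD Dfin.
have [S2 [mS2 ES2 N2]] := borel_hull mE2 mD Dfin.
have mDT := borel_cara mD; have mS1T := borel_cara mS1.
have mS2T := borel_cara mS2.
have u1 : real_ug (fun y => clamp ((q y - t) / h)) (fun y => h^-1%:E * g y).
  apply: (real_ug_lipschitz_comp qg hV0) => y z.
  apply: le_trans (clamp_lip _ _) _.
  rewrite -mulrBl opprB addrA subrK normrM mulrC.
  by rewrite (@ger0_norm _ h^-1).
have w1 y : (0 < clamp ((q y - t) / h))%R -> (S1 `&` D) y.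
  move=> /clamp_gt0; rewrite pmulr_lgt0 ?invr_gt0// subr_gt0 => tq.
  by split; [exact: ES1|exact: qD].
have w2 y : (clamp ((q y - t) / h) < 1)%R -> S2 y.
  move=> /clamp_lt1; rewrite ltr_pdivrMr// mul1r ltrBlDl => qt; exact: ES2.
(* [g] itself is the error term of [real_ug_between]: it enters without the factor [h^-1], hence
   stays bounded as [h] tends to 0. *)
have fin gamma : curve_integral gamma g < +oo ->
    curve_integral gamma (fun y => h^-1%:E * g y) < +oo.
  rewrite /curve_integral => gfin; rewrite ge0_integralZl//; last exact: borel_fun_curve.
  by rewrite lte_mul_pinfty// lee_fin.
have u2 := real_ug_between u1 (fun y => clamp_itv _) (measurableI _ _ mS1 mD) w1 mS2 w2
  mg g0 fin.
eexists; first exact: u2.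
have mI : measurable (S1 `&` D `&` S2 : set T) by do 2 apply: measurableI => //.
have mhg : measurable_fun setT ((fun y => h^-1%:E * g y) : T -> \bar R).
  exact: measurable_funeM.
have hg0 y : 0 <= h^-1%:E * g y by rewrite mule_ge0// lee_fin.
have mgI := (@measurable_restrictT _ _ T _ _ _ mI).1 (measurable_funTS mhg).
rewrite ge0_integralD//; last first.
- exact: emeasurable_funD.
- by move=> y _; rewrite adde_ge0.
- by move=> y _; apply: erestrict_ge0.
rewrite ge0_integralD//; apply: leeD2r.
rewrite -integral_mkcond ge0_integralZl//; last exact: measurable_funTS.
apply: lee_wpmul2l; first by rewrite lee_fin.
(* The null set by which the Borel hulls exceed the level sets inside [D]. *)
pose N := (D `&` (S1 `\` E1)) `|` (D `&` (S2 `\` E2)).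
have mN : measurable (N : set T).
  by apply: measurableU; apply: measurableI => //; exact: measurableD.
have N0 : m N = 0.
  apply/eqP; rewrite eq_le measure_ge0 andbT.
  by apply: le_trans (outer_measureU2 mu _ _) _; rewrite N1 N2 adde0.
rewrite (ge0_negligible_integral mN mI _ _ N0)//; last exact: measurable_funTS.
apply: ge0_subset_integral => //.
- exact: measurableD.
- exact: measurable_funTS.
- move=> y [[[S1y Dy] S2y] nNy] /=; apply/andP; split.
  + rewrite ltNge; apply/negP => qt; apply: nNy; left; split=> //; split=> //.
    by move=> tq; move: qt; rewrite leNgt tq.
  + rewrite leNgt; apply/negP => qt; apply: nNy; right; split=> //; split=> //.
    by move=> qt'; have := lt_trans qt qt'; rewrite ltxx.
Qed.

(** The weight [w y] dominates the capacity of [ball y (3 * rho y)] by [cap1_ball]. Vitali's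
    covering and subadditivity reduce the claim to sums over disjoint balls; positive weights with
    bounded sums make the disjoint family countable. *)
Lemma cap1_vitali (S D : set X) (rho w : X -> R) (M N : R) :
  measurable (D : set borelT) -> mu D < +oo ->
  (forall y, S y -> [/\ (0 < rho y <= M)%R, (0 < w y)%R, ball y (6 * rho y) `<=` D &
     (3 * rho y)^-1%:E * mu (ball y (6 * rho y)) <= (w y)%:E]) ->
  (forall s : seq X, uniq s -> {subset s <= S} ->
     trivIset [set` s] (fun y => ball y (rho y)) -> (\sum_(y <- s) w y <= N)%R) ->
  cap1 mu S D <= N%:E.
Proof.
move=> mD Dfin SP sN.
have [|J [JS tJ SJ]] := @vitali_cover_metric R X S rho M.
  by move=> y /SP[].
have sJ (s : seq X) : uniq s -> {subset s <= J} -> (\sum_(y <- s) w y <= N)%R.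
  move=> us ssJ; apply: sN => //.
  - by move=> y /ssJ/set_mem/JS/mem_set.
  - by apply: sub_trivIset tJ => y /= /ssJ/set_mem.
have /countable_injP[f injf] : countable J.
  by apply: (@countable_bounded_sums _ _ _ w N) => // y /JS/SP[].
pose good k := `[< exists2 y, J y & f y = k >].
(* [z] inverts the enumeration [f] of [J]; the default [point] is taken only at indices outside its
   image, where [A k] is empty. *)
pose z k := xget point [set y | J y /\ f y = k].
have zP k : good k -> J (z k) /\ f (z k) = k.
  move=> /asboolP[y Jy fy].
  have : [set y | J y /\ f y = k] (z k) by apply: xgetPex; exists y.
  by [].
pose A k := if good k then ball (z k) (3 * rho (z k)) else set0.
have SA : S `<=` \bigcup_k A k.
  move=> x /SJ[y Jy xy]; exists (f y) => //; rewrite /A.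
  have gy : good (f y) by apply/asboolP; exists y.
  rewrite gy; have [Jz fz] := zP _ gy.
  by rewrite (injf _ _ (mem_set Jz) (mem_set Jy) fz).
rewrite (le_trans (cap1_mono _ SA))// (le_trans (cap1_bigcup _ mD Dfin))//.
pose c k := if good k then w (z k) else 0%R.
have cA k : cap1 mu (A k) D <= (c k)%:E.
  rewrite /A /c; case: ifPn => [|_]; last by rewrite cap1_set0.
  move=> /zP[/JS/SP[/andP[r0 _] _ rD rw] _].
  have E6 : (2 * (3 * rho (z k)) = 6 * rho (z k))%R by lra.
  apply: le_trans (cap1_ball _ mD Dfin _) _; rewrite ?E6//.
  by rewrite mulr_gt0.
apply: lime_le.
  by apply: is_cvg_nneseries => k _ _; exact: cap1_ge0.
near=> n; apply: (@le_trans _ _ (\sum_(0 <= k < n) (c k)%:E)).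
  by apply: lee_sum => k _.
rewrite sumEFin lee_fin /c -big_mkcond/= -big_filter -(big_map z xpredT w).
apply: sJ.
- rewrite map_inj_in_uniq ?filter_uniq ?iota_uniq// => i j.
  by rewrite !mem_filter => /andP[/zP[_ fi] _] /andP[/zP[_ fj] _] zij; rewrite -fi zij fj.
- by move=> y /mapP[k]; rewrite mem_filter => /andP[/zP[Jz _] _] ->; exact: mem_set.
Unshelve. all: by end_near.
Qed.

End capacity.

(** * Doubling measures and the Poincare inequality *)

Section doubling.
Context {R : realType} {X : completePMetricType R}.
Variable mu : {outer_measure set X -> \bar R}.
Variable Cd : R.
Hypothesis Cd1 : (1 <= Cd)%R.
Hypothesis dbl : forall (x : X) (r : R), (0 < r)%R ->
  [/\ 0 < mu (ball x (2 * r)%R),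
      mu (ball x (2 * r)%R) <= Cd%:E * mu (ball x r) &
      Cd%:E * mu (ball x r) < +oo].

Definition vol (x : X) (r : R) : R := fine (mu (ball x r)).

Lemma ball_finite (x : X) (r : R) : mu (ball x r) < +oo.
Proof.
have [r0|r0] := ltP 0%R r; last first.
  rewrite (_ : ball x r = set0) ?outer_measure0//; apply/seteqP; split=> // y.
  by rewrite ballEmdist/= ltNge (le_trans r0)// mdist_ge0.
have [_ _] := dbl x r0; apply: le_lt_trans.
by rewrite -{1}[mu _]mul1e lee_wpmul2r// lee_fin.
Qed.

Lemma volE (x : X) (r : R) : mu (ball x r) = (vol x r)%:E.
Proof. by rewrite /vol fineK// ge0_fin_numE// ball_finite. Qed.

Lemma vol_gt0 (x : X) (r : R) : (0 < r)%R -> (0 < vol x r)%R.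
Proof.
move=> r0; have r20 : (0 < r / 2)%R by rewrite divr_gt0.
have [+ _ _] := dbl x r20; rewrite (_ : 2 * (r / 2) = r)%R; last by lra.
by rewrite volE lte_fin.
Qed.

Lemma vol_le (x y : X) (r s : R) : ball x r `<=` ball y s -> (vol x r <= vol y s)%R.
Proof. by move=> xy; rewrite -lee_fin -!volE le_outer_measure. Qed.

Lemma vol_double (x : X) (r : R) : (0 < r)%R -> (vol x (2 * r) <= Cd * vol x r)%R.
Proof. by move=> r0; have [_ + _] := dbl x r0; rewrite !volE -EFinM lee_fin. Qed.

Lemma vol_dilate (K : R) : exists2 C : R, (1 <= C)%R &
  forall (x : X) (r : R), (0 < r)%R -> (vol x (K * r) <= C * vol x r)%R.
Proof.
have H (n : nat) (x : X) (r : R) : (0 < r)%R -> (vol x (2 ^+ n * r) <= Cd ^+ n * vol x r)%R.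
  move=> r0; elim: n => [|n IH]; first by rewrite !expr0 !mul1r.
  rewrite !exprS -!mulrA (le_trans (vol_double _ _)) ?mulr_gt0 ?exprn_gt0//.
  by rewrite ler_wpM2l// (le_trans _ Cd1).
pose n := Num.truncn K.
exists (Cd ^+ n.+1)%R => [|x r r0]; first exact: exprn_ege1.
apply: le_trans (H _ _ _ r0); apply: vol_le; apply: le_ball.
rewrite ler_pM2r// (le_trans (ltW (truncnS_gt K)))//.
by rewrite -natrX ler_nat ltnW// ltn_expl.
Qed.

End doubling.

Section poincare.
Context {R : realType} {X : completePMetricType R}.
Variable mu : {outer_measure set X -> \bar R}.
Hypothesis hreg : borel_regular mu.
Variable Cd : R.
Hypothesis Cd1 : (1 <= Cd)%R.
Hypothesis dbl : forall (x : X) (r : R), (0 < r)%R ->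
  [/\ 0 < mu (ball x (2 * r)%R),
      mu (ball x (2 * r)%R) <= Cd%:E * mu (ball x r) &
      Cd%:E * mu (ball x r) < +oo].
Local Notation borelT := (g_sigma_algebraType (@open X)).
Local Notation T := (caratheodory_type mu).
Local Notation m := (cara_measure mu).
Local Notation vol := (vol mu).
Let volE := volE Cd1 dbl.
Let vol_gt0 := vol_gt0 Cd1 dbl.
Let vol_le := vol_le Cd1 dbl.

Lemma cap1_density_null (g : X -> \bar R) (x : X) (r c : R) :
  borel_fun g -> (forall y, 0 <= g y) -> \int[m]_y g y < +oo ->
  (0 < r)%R -> (0 < c)%R ->
  cap1 mu [set y | ball x r y /\ forall sigma, (0 < sigma)%R ->
    exists s, [/\ (0 < s)%R, (s < sigma)%R &
      (c * vol y s)%:E <= s%:E * \int[m]_(z in ball y s) g z]]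
    (ball x (2 * r)) = 0.
Proof.
move=> mg g0 gfin r0 c0; set S := [set y | _].
apply/eqP; rewrite eq_le cap1_ge0 andbT; apply/lee_addgt0Pr => e e0; rewrite add0e.
have [C C1 volC] := vol_dilate Cd1 dbl 6.
have C0 : (0 < C)%R by exact: lt_le_trans C1.
(* Solves [2 * C / (3 * c) * e1 = e], the covering bound obtained below. *)
pose e1 := (3 * c * e / (2 * C))%R.
have e10 : (0 < e1)%R by rewrite divr_gt0// !mulr_gt0.
have [n [h [mh h0 gh he]]] :=
  integrable_le_cst_add (borel_fun_cara hreg mg) g0 gfin e10.
have /choice[rho rhoP] : forall y, exists s, S y -> [/\ (0 < s)%R, (6 * s <= r)%R &
    ((c / 2) * vol y s)%:E <= s%:E * \int[m]_(z in ball y s) h z].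
  move=> y; have [[xy Sy]|nSy] := pselect (S y); last by exists 0%R.
  (* The first bound keeps [ball y (6 * s)] inside [ball x (2 * r)]. The second makes the constant
     part [n] of [g] account for at most half of [c * vol y s], so that [h] carries the other
     half. *)
  pose sigma := (Num.min (r / 6) (c / (2 * n.+1%:R)))%R.
  have sigma0 : (0 < sigma)%R by rewrite lt_min !divr_gt0// mulr_gt0// ltr0n.
  have [s [s0 ssig cs]] := Sy _ sigma0; exists s => _; split=> //.
    by move: ssig; rewrite lt_min ltr_pdivlMr// => /andP[/ltW + _]; rewrite mulrC.
  have mhB : measurable_fun (ball y s : set T) h by exact: measurable_funTS.
  have Bgh : \int[m]_(z in ball y s) g z <=
      (n%:R * vol y s)%:E + \int[m]_(z in ball y s) h z.
    apply: (@le_trans _ _ (\int[m]_(z in ball y s) (n%:R%:E + h z))).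
      apply: ge0_le_integral => //; first exact: ball_cara.
      - by apply: measurable_funTS; exact: borel_fun_cara.
      - exact: emeasurable_funD.
    rewrite ge0_integralD//; last exact: ball_cara.
    by rewrite integral_cst ?EFinM -?volE//; exact: ball_cara.
  have [hy|hfin] := eqVneq (\int[m]_(z in ball y s) h z) +oo.
    by rewrite hy gt0_muley ?leey// lte_fin.
  have hE : \int[m]_(z in ball y s) h z = (fine (\int[m]_(z in ball y s) h z))%:E.
    by rewrite fineK// ge0_fin_numE ?ltey// integral_ge0.
  move: cs Bgh; rewrite hE; set H := fine _ => cs Bgh.
  have s0' : 0 <= s%:E by rewrite lee_fin ltW.
  have := le_trans cs (lee_wpmul2l s0' Bgh).
  rewrite -EFinD -!EFinM !lee_fin.
  have ns : (s * (n%:R * vol y s) <= (c / 2) * vol y s)%R.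
    rewrite mulrA ler_wpM2r// ?(ltW (vol_gt0 y s0))//.
    move: ssig; rewrite lt_min => /andP[_]; rewrite ltr_pdivlMr ?mulr_gt0 ?ltr0n// => sc.
    have : (s * n%:R <= s * n.+1%:R)%R by rewrite ler_wpM2l ?(ltW s0)// ler_nat.
    lra.
  lra.
pose w y := (C * vol y (rho y) / (3 * rho y))%R.
apply: (@cap1_vitali _ _ mu hreg S _ rho w r) => //.
- exact: borel_ball.
- exact: (ball_finite Cd1 dbl).
- move=> y Sy; have [s0 sr _] := rhoP y Sy; split.
  + rewrite s0/=; lra.
  + by rewrite divr_gt0// mulr_gt0// vol_gt0.
  + move=> z; case: Sy => + _; rewrite !ballEmdist/= => xy yz.
    have := metric_triangle x y z; lra.
  + rewrite [mu _]volE -EFinM lee_fin /w mulrC ler_wpM2r ?volC//.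
    by rewrite invr_ge0 mulr_ge0// ltW.
- move=> s us sS ts.
  rewrite -lee_fin -sumEFin.
  apply: (@le_trans _ _ ((2 * C / (3 * c))%:E * \int[m]_z h z)); last first.
    apply: (@le_trans _ _ ((2 * C / (3 * c))%:E * e1%:E)).
      by rewrite lee_wpmul2l// lee_fin divr_ge0// mulr_ge0// ltW.
    rewrite -EFinM lee_fin le_eqVlt; apply/orP; left; apply/eqP; rewrite /e1.
    by field; rewrite !gt_eqF.
  have := @sum_integral_trivIset _ T _ m _ s (fun y => ball y (rho y)) h.
  move=> /(_ (fun y => ball_cara hreg _ _) us ts mh h0) H.
  apply: le_trans (lee_wpmul2l _ H); last by rewrite lee_fin divr_ge0// mulr_ge0// ltW.
  rewrite ge0_sume_distrr; last by move=> y _; exact: integral_ge0.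
  rewrite big_seq [leRHS]big_seq; apply: lee_sum => y /sS/set_mem/rhoP[s0 _ Hy].
  have := lee_wpmul2l (_ : 0 <= (2 * C / (3 * c * rho y))%:E) Hy.
  rewrite lee_fin divr_ge0 ?mulr_ge0 ?(ltW c0) ?(ltW C0) ?(ltW s0)// => /(_ isT).
  rewrite muleA -!EFinM; congr (_ <= _).
    by congr EFin; rewrite /w; field; rewrite !gt_eqF.
  by congr (_%:E * _); field; rewrite !gt_eqF.
Qed.

Variables CP lam : R.
Hypothesis CP1 : (1 <= CP)%R.
Hypothesis lam1 : (1 <= lam)%R.
Hypothesis poincare : forall (x : X) (r : R), (0 < r)%R ->
  forall u g : X -> \bar R, loc_integrable mu u -> upper_gradient u g ->
  mean mu (fun y => `|u y - mean mu u (ball x r)|) (ball x r)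
    <= (CP * r)%R%:E * mean mu g (ball x (lam * r)%R).

Lemma integrable_test (q : X -> R) (x : X) (r : R) :
  measurable_fun setT (q : T -> R) -> (forall y, 0 <= q y <= 1)%R ->
  m.-integrable (ball x r) (EFin \o q).
Proof.
move=> mq q01; apply: (@measurable_bounded_integrable _ T) => //.
- exact: ball_cara.
- exact: (ball_finite Cd1 dbl).
- exact: measurable_funTS.
- exists 1%R; split => // M M1 y _ /=; have /andP[q0 q1] := q01 y.
  by rewrite ger0_norm// (le_trans q1)// ltW.
Qed.

(* On [P0] the integrand [|q - mean q|] is the mean of [q]. *)
Lemma poincare_vanishing (q : X -> R) (g : X -> \bar R) (x : X) (r K : R) (P0 : set X) :
  measurable_fun setT (q : T -> R) -> (forall y, 0 <= q y <= 1)%R ->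
  real_ug q g -> (0 < r)%R -> P0 `<=` ball x r -> measurable (P0 : set T) ->
  (forall y, P0 y -> q y = 0%R) -> (vol x r)%:E <= K%:E * mu P0 ->
  \int[m]_(y in ball x r) (q y)%:E <=
    (K * CP * r)%:E * \int[m]_(y in ball x (lam * r)) g y.
Proof.
move=> mq q01 qg r0 P0B mP0 q0 KP0; have [g0 mg _] := qg.
have mB := ball_cara hreg x r.
have v0 := vol_gt0 x r0.
have lr0 : (0 < lam * r)%R by rewrite mulr_gt0// (lt_le_trans _ lam1).
have V0 := vol_gt0 x lr0.
have vV : (vol x r <= vol x (lam * r))%R.
  by apply: vol_le => //; apply: le_ball; rewrite ler_peMl// ltW.
have P0fin : mu P0 \is a fin_num.
  by rewrite ge0_fin_numE// (le_lt_trans (le_outer_measure _ _ _ P0B))// (ball_finite Cd1 dbl).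
move: KP0; rewrite -(fineK P0fin) -EFinM lee_fin; set p := fine (mu P0) => KP0.
have p0 : (0 <= p)%R by exact: fine_ge0.
have K0 : (0 < K)%R.
  rewrite ltNge; apply/negP => K0; have : (K * p <= 0)%R by rewrite mulr_le0_ge0.
  lra.
have qi := integrable_test x r mq q01.
have afin := integrable_fin_num mB qi.
set a := \int[m]_(y in ball x r) (q y)%:E.
have aE : a = (fine a)%:E by rewrite fineK.
have a0 : (0 <= fine a)%R.
  by apply: fine_ge0; apply: integral_ge0 => y _; rewrite lee_fin; have /andP[] := q01 y.
pose c := (fine a / vol x r)%R.
have c0 : (0 <= c)%R by rewrite divr_ge0// ltW.
have meanE : mean mu (EFin \o q) (ball x r) = c%:E.
  by rewrite /mean -/a aE volE inver gt_eqF// -EFinM.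
have li : loc_integrable mu (EFin \o q) by move=> y; exists 1%R => //; exact: integrable_test.
have := poincare x r0 li qg; rewrite meanE.
have [Gy|Gfin] := eqVneq (\int[m]_(y in ball x (lam * r)) g y) +oo.
  by rewrite Gy gt0_muley ?leey// lte_fin !mulr_gt0// (lt_le_trans _ CP1).
have G0 : 0 <= \int[m]_(y in ball x (lam * r)) g y by apply: integral_ge0.
have GE : \int[m]_(y in ball x (lam * r)) g y =
    (fine (\int[m]_(y in ball x (lam * r)) g y))%:E.
  by rewrite fineK// ge0_fin_numE// ltey.
move: GE G0; set G := fine _ => GE; rewrite GE lee_fin => G0.
rewrite /mean !volE !inver !gt_eqF// GE -!EFinM => H.
have Hp : (c * p / vol x r)%:E <= (CP * r * (G / vol x (lam * r)))%:E.
  apply: le_trans H; rewrite EFinM lee_wpmul2r ?lee_fin ?invr_ge0 ?(ltW v0)//.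
  rewrite EFinM /p fineK//.
  have -> : c%:E * mu P0 = \int[m]_(y in P0) c%:E by rewrite integral_cst.
  apply: (@le_trans _ _ (\int[m]_(y in P0) `|(EFin \o q) y - c%:E|)).
    apply: ge0_le_integral => //.
    - apply: measurableT_comp => //; apply: emeasurable_funB => //.
      by apply/measurable_EFinP; exact: measurable_funTS.
    - by move=> y /q0 /= ->; rewrite lee_fin sub0r normrN ler_norm.
  apply: ge0_subset_integral => //.
  apply: measurableT_comp => //; apply: emeasurable_funB => //.
  by apply/measurable_EFinP; exact: measurable_funTS.
rewrite aE lee_fin; move: Hp; rewrite lee_fin ler_pdivrMr// => Hp.
have aE' : (fine a = c * vol x r)%R by rewrite /c divfK// gt_eqF.
rewrite aE'.
apply: (@le_trans _ _ (c * (K * p))%R); first by rewrite ler_wpM2l.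
have -> : (c * (K * p) = K * (c * p))%R by ring.
have -> : (K * CP * r * G = K * (CP * (r * G)))%R by ring.
rewrite ler_pM2l//; apply: le_trans Hp _.
rewrite -!mulrA ler_wpM2l ?(le_trans _ CP1)// ler_wpM2l ?(ltW r0)//.
by rewrite ler_piMr// mulrC ler_pdivrMr// mul1r.
Qed.

(* If the annulus were empty, the cutoff would be an indicator function with upper
   gradient 0, contradicting the Poincare inequality on a large ball. *)
Lemma annulus_nonempty (x p : X) (a b : R) : (0 < a)%R -> (a < b)%R ->
  (b <= mdist x p)%R -> exists z, (a <= mdist x z < b)%R.
Proof.
move=> a0 ab bxp; apply: contrapT => noz.
have ring_empty z : ~ (a <= mdist x z < b)%R by move=> zab; apply: noz; exists z.
pose q := cutoff x a b.
have q01 y : (0 <= q y <= 1)%R by exact: clamp_itv.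
have mq := measurable_cutoff hreg x a b.
have k0 : (0 < (b - a)^-1)%R by rewrite invr_gt0 subr_gt0.
have fin0 gamma : curve_integral gamma (cst 0 : X -> \bar R) < +oo ->
    curve_integral gamma (cst (b - a)^-1%:E : X -> \bar R) < +oo.
  by move=> _; rewrite curve_integral_cst ltry.
have qS1 y : (0 < q y)%R -> ball x b y by exact: cutoff_gt0.
have qS2 y : (q y < 1)%R -> (~` ball x a) y.
  rewrite ballEmdist/= => qy /ltW /(cutoff1 ab) qy1; move: qy.
  by rewrite /q qy1 ltxx.
have u1 := real_ug_between (cutoff_ug x ab) q01 (borel_ball x b) qS1
  (measurableC (borel_ball x a)) qS2 (measurable_cst 0) (fun=> lexx 0) fin0.
have u0 : real_ug q (cst 0).
  apply: real_ug_le u1 (measurable_cst _) _ => y.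
  rewrite patchE ifF ?adde0//; apply/negP => /set_mem[].
  rewrite !ballEmdist/= => yb nya; apply: (ring_empty y).
  by rewrite yb andbT leNgt; apply/negP.
(* With the annulus empty, [q] is nonzero only in [ball x a], which the ball of radius [d - a] about
   [p] misses. *)
pose d := mdist x p; pose rho := (d - a)%R.
have d0 : (0 < d)%R by rewrite (lt_le_trans _ bxp)// (lt_trans a0).
have rho0 : (0 < rho)%R by rewrite subr_gt0 (lt_le_trans ab).
have pB : ball p rho `<=` ball x (2 * d).
  move=> y; rewrite !ballEmdist/= => py; have := metric_triangle x p y.
  rewrite -/d; rewrite /rho in py; lra.
have qp y : ball p rho y -> q y = 0%R.
  rewrite ballEmdist/= => py; apply: cutoff0 => //; rewrite leNgt; apply/negP => yb.
  apply: (ring_empty y); rewrite yb andbT.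
  have := metric_triangle x y p; rewrite -/d (metric_sym y p); rewrite /rho in py; lra.
have d20 : (0 < 2 * d)%R by lra.
have KP : (vol x (2 * d))%:E <= (vol x (2 * d) / vol p rho)%:E * mu (ball p rho).
  by rewrite volE -EFinM divfK// gt_eqF// vol_gt0.
have := poincare_vanishing mq q01 u0 d20 pB (ball_cara hreg p rho) qp KP.
rewrite integral0 mule0; apply/negP; rewrite -ltNge.
have ad : (a <= 2 * d)%R by rewrite /d; lra.
apply: (@lt_le_trans _ _ (\int[m]_(y in ball x a) (1%R)%:E)).
  rewrite integral_cst//; last exact: ball_cara.
  by rewrite mul1e [X in _ < X](volE x a) lte_fin vol_gt0.
apply: (@le_trans _ _ (\int[m]_(y in ball x a) (q y)%:E)).
  apply: ge0_le_integral => //.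
  - exact: ball_cara.
  - by apply/measurable_EFinP; exact: measurable_funTS.
  - move=> y; rewrite ballEmdist/= => ya; rewrite lee_fin /q (cutoff1 ab)//; exact: ltW.
apply: ge0_subset_integral => //.
- exact: ball_cara.
- exact: ball_cara.
- by apply/measurable_EFinP; exact: measurable_funTS.
- by move=> y _; rewrite lee_fin; have /andP[] := q01 y.
- exact: le_ball.
Qed.

(** * The boxing argument *)

(** As [h] decreases to 0 the truncations increase to the indicator of the superlevel set, so for
    small [h] they capture half of its measure. The sets [F n], on which the truncation is 1 once
    [h <= n.+1^-1], exhaust the superlevel set in [B]. *)
Lemma level_measure_half (q : X -> R) (t : R) (B : set X) :
  measurable_fun setT (q : T -> R) -> measurable (B : set T) -> mu B < +oo ->
  exists2 h0 : R, (0 < h0)%R & forall h, (0 < h)%R -> (h <= h0)%R ->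
    mu ([set y | (t < q y)%R] `&` B) <=
      2%:E * \int[m]_(y in B) (clamp ((q y - t) / h))%:E.
Proof.
move=> mq mB Bfin; set E := [set y | _].
have mE : measurable (E : set T) by exact: level_set_measurable.
pose F (n : nat) : set T := [set y | (t + n.+1%:R^-1 <= q y)%R] `&` B.
have mF n : measurable (F n).
  apply: measurableI => //.
  have := mq measurableT `[(t + n.+1%:R^-1)%R, +oo[%classic (measurable_itv _).
  by rewrite setTI; congr measurable; apply/seteqP; split => y /=; rewrite in_itv/= andbT.
have FE : \bigcup_n F n = E `&` B.
  apply/seteqP; split=> [y [n _ [/= tq By]]|y [/= tq By]].
    by split=> //; rewrite /E/= (lt_le_trans _ tq)// ltrDl invr_gt0 ltr0n.
  have qt0 : (0 < q y - t)%R by rewrite subr_gt0.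
  exists (Num.truncn (q y - t)^-1) => //; split=> //=.
  rewrite -lerBrDl -[leRHS]invrK lef_pV2 ?posrE ?invr_gt0// ?ltr0n//.
  by rewrite ltW// truncnS_gt.
have cv : m (F n) @[n --> \oo] --> m (\bigcup_n F n).
  apply: nondecreasing_cvg_mu => //; first exact: bigcup_measurable.
  move=> n k nk; apply/subsetPset => y [/= tq By]; split=> //=.
  by rewrite (le_trans _ tq)// lerD2l lef_pV2 ?posrE ?ltr0n// ler_nat.
have EBfin : mu (E `&` B) \is a fin_num.
  by rewrite ge0_fin_numE// (le_lt_trans _ Bfin)// le_outer_measure.
have EB0 : 0 <= mu (E `&` B) by exact: outer_measure_ge0.
have [EBz|EBnz] := eqVneq (mu (E `&` B)) 0.
  exists 1%R => // h _ _; rewrite EBz mule_ge0//; apply: integral_ge0 => y _.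
  by rewrite lee_fin; have /andP[] := clamp_itv ((q y - t) / h).
have [n nP] : exists n, mu (E `&` B) <= 2%:E * m (F n).
  apply: contrapT => nn; have {}nn n : m (F n) <= (fine (mu (E `&` B)) / 2)%:E.
    rewrite leNgt; apply/negP => Hn; apply: nn; exists n.
    rewrite -(fineK EBfin); apply: (@le_trans _ _ (2%:E * (fine (mu (E `&` B)) / 2)%:E)).
      by rewrite -EFinM lee_fin mulrC divfK.
    by rewrite lee_wpmul2l// ltW.
  have : m (\bigcup_n F n) <= (fine (mu (E `&` B)) / 2)%:E.
    rewrite -(cvg_lim _ cv)//; apply: lime_le; first by apply: cvgP cv.
    by apply: nearW.
  rewrite FE -[leLHS](fineK EBfin) lee_fin.
  have : (0 < fine (mu (E `&` B)))%R.
    by rewrite fine_gt0// lt0e EBnz EB0/= -ge0_fin_numE.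
  lra.
exists (n.+1%:R^-1)%R => [|h h0 hn]; first by rewrite invr_gt0 ltr0n.
apply: (le_trans nP); rewrite lee_wpmul2l//.
have wm : measurable_fun setT (fun y : T => (clamp ((q y - t) / h))%:E).
  apply/measurable_EFinP; apply: measurable_clamp; apply: measurable_funM => //.
  exact: measurable_funB.
have w0 (y : X) : 0 <= (clamp ((q y - t) / h))%:E.
  by rewrite lee_fin; have /andP[] := clamp_itv ((q y - t) / h).
apply: (@le_trans _ _ (\int[m]_(y in F n) (clamp ((q y - t) / h))%:E)); last first.
  by apply: ge0_subset_integral => //; [exact: measurable_funTS|move=> y []].
rewrite -[leLHS]mul1e -integral_cst//; apply: ge0_le_integral => //.
  exact: measurable_funTS.
move=> y [/= tq _]; rewrite lee_fin clamp1// ler_pdivlMr// mul1r.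
by rewrite (le_trans hn)// lerBrDl.
Qed.

Lemma superlevel_small : exists2 K : R, (0 < K)%R & forall (x p : X) (r : R) (q : X -> R)
    (g : X -> \bar R) (I t : R),
  (0 < r)%R -> (4 * r <= mdist x p)%R -> measurable_fun setT (q : T -> R) ->
  (forall y, 0 <= q y <= 1)%R -> (forall y, ~ ball x (2 * r) y -> q y = 0%R) ->
  real_ug q g -> \int[m]_y g y <= I%:E -> (8^-1 <= t)%R ->
  mu [set y | (t < q y)%R] <= (K * r * I)%:E.
Proof.
have [C C1 volC] := vol_dilate Cd1 dbl 16.
exists (8 * (C * CP * 4))%R.
  by rewrite !mulr_gt0// ?(lt_le_trans _ C1)// ?(lt_le_trans _ CP1).
move=> x p r q g I t r0 xp mq q01 qD qg gI t8.
have [g0 mg _] := qg.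
(* The ball of radius [r / 2] about [z] misses [ball x (2 * r)], where [q] lives, and is comparable
   to [ball x (4 * r)], which lies in [ball z (8 * r)]; hence the factor 16 above. Chebyshev's
   inequality at level 1/8 then gives the 8 in the constant. *)
have [|||z /andP[xz zx]] := @annulus_nonempty x p (5 / 2 * r)%R (7 / 2 * r)%R; [lra..|].
have r20 : (0 < r / 2)%R by rewrite divr_gt0.
have r40 : (0 < 4 * r)%R by lra.
have PB : ball z (r / 2) `<=` ball x (4 * r).
  move=> y; rewrite !ballEmdist/= => zy; have := metric_triangle x z y; lra.
have qP y : ball z (r / 2) y -> q y = 0%R.
  rewrite ballEmdist/= => zy; apply: qD; rewrite ballEmdist/=.
  have := metric_triangle x y z; rewrite (metric_sym y z); lra.
have KP : (vol x (4 * r))%:E <= C%:E * mu (ball z (r / 2)).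
  rewrite volE -EFinM lee_fin; apply: le_trans (volC z _ r20); apply: vol_le.
  move=> y; rewrite !ballEmdist/= => xy; have := metric_triangle z x y.
  rewrite (metric_sym z x); lra.
have := poincare_vanishing mq q01 qg r40 PB (ball_cara hreg z _) qP KP.
set W := \int[m]_(y in _) (q y)%:E => HW.
have C0 : (0 < C)%R by exact: lt_le_trans C1.
have CP0 : (0 < CP)%R by exact: lt_le_trans CP1.
have HW2 : W <= (C * CP * (4 * r) * I)%:E.
  apply: (le_trans HW); rewrite [leRHS]EFinM lee_wpmul2l//.
    by rewrite lee_fin !mulr_ge0// ltW.
  apply: le_trans gI; apply: ge0_subset_integral => //; first exact: ball_cara.
  exact: borel_fun_cara.
pose E := [set y | (t < q y)%R].
have mE : measurable (E : set T) by exact: level_set_measurable.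
have EB : E `<=` ball x (4 * r).
  move=> y tq; apply: contrapT => nB; have : q y = 0%R.
    apply: qD => xy; apply: nB; move: xy; apply: le_ball; lra.
  rewrite /E /= in tq; lra.
have HE : mu E <= 8%:E * W.
  apply: (@le_trans _ _ (8%:E * \int[m]_(y in E) (8^-1)%:E)).
    by rewrite integral_cst// muleA -EFinM divff// mul1e.
  rewrite lee_wpmul2l//.
  apply: (@le_trans _ _ (\int[m]_(y in E) (q y)%:E)).
    apply: ge0_le_integral => //.
    - by apply/measurable_EFinP; exact: measurable_funTS.
    - by move=> y tq; rewrite lee_fin (le_trans t8)// ltW.
  apply: ge0_subset_integral => //; first exact: ball_cara.
  - by apply/measurable_EFinP; exact: measurable_funTS.
  - by move=> y _; rewrite lee_fin; have /andP[] := q01 y.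
apply: (le_trans HE); apply: le_trans (lee_wpmul2l _ HW2) _; first by rewrite lee_fin.
by rewrite -EFinM lee_fin le_eqVlt; apply/orP; left; apply/eqP; ring.
Qed.

Lemma cap1_boxing : exists delta C : R, [/\ (0 < delta)%R, (0 < C)%R &
  forall (x p : X) (r : R) (q : X -> R) (g : X -> \bar R) (I : R),
  (0 < r)%R -> (4 * r <= mdist x p)%R -> measurable_fun setT (q : T -> R) ->
  (forall y, 0 <= q y <= 1)%R -> (forall y, ~ ball x (2 * r) y -> q y = 0%R) ->
  real_ug q g -> (0 < I)%R -> \int[m]_y g y <= I%:E -> (r * I <= delta * vol x r)%R ->
  cap1 mu [set y | ball x r y /\ forall sigma, (0 < sigma)%R ->
      exists s, [/\ (0 < s)%R, (s < sigma)%R &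
        (vol y s)%:E <= 2%:E * mu ([set z | (4^-1 < q z)%R] `&` ball y s)]]
    (ball x (2 * r)) <= (C * I)%:E].
Proof.
have [K K0 small] := superlevel_small.
have [Cb Cb1 volCb] := vol_dilate Cd1 dbl (24 * lam).
have [Cc Cc1 volCc] := vol_dilate Cd1 dbl (6 * lam).
have Cb0 : (0 < Cb)%R by exact: lt_le_trans Cb1.
have Cc0 : (0 < Cc)%R by exact: lt_le_trans Cc1.
have CP0 : (0 < CP)%R by exact: lt_le_trans CP1.
have Cd0 : (0 < Cd)%R by exact: lt_le_trans Cd1.
have lam0 : (0 < lam)%R by exact: lt_le_trans lam1.
(* [delta] is small enough to exclude density 1/2 at scales comparable to [R0]. In [C], the first
   factor comes from dilating the balls, [8 * Cd * CP] from the Poincare estimate [each], and 11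
   from the energy of the truncation. *)
exists (4 * K * Cb)^-1%R, (Cc / (3 * lam) * (8 * Cd * CP) * 11)%R; split.
- by rewrite invr_gt0 !mulr_gt0.
- by rewrite !mulr_gt0// invr_gt0 mulr_gt0.
move=> x p r q g I r0 xp mq q01 qD qg I0 gI rI; set F := [set y | _].
have [g0 mg _] := qg.
have mgT := borel_fun_cara hreg mg.
have mle (t : R) : measurable ([set y | (q y <= t)%R] : set T).
  have := mq measurableT `]-oo, t]%classic (measurable_itv _).
  by rewrite setTI; congr measurable; apply/seteqP; split => y /=; rewrite in_itv/=.
have mlt (s t : R) : measurable ([set y | (s < q y <= t)%R] : set T).
  have := mq measurableT `]s, t]%classic (measurable_itv _).
  by rewrite setTI; congr measurable; apply/seteqP; split => y /=; rewrite in_itv/=.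
have gfinA (A : set X) : measurable (A : set T) -> \int[m]_(y in A) g y <= I%:E.
  move=> mA; apply: le_trans gI; exact: ge0_subset_integral.
have gE (A : set X) : measurable (A : set T) ->
    \int[m]_(y in A) g y = (fine (\int[m]_(y in A) g y))%:E.
  move=> mA; rewrite fineK// ge0_fin_numE ?integral_ge0//.
  by rewrite (le_lt_trans (gfinA A mA))// ltry.
pose Phi (t : R) := fine (\int[m]_(y in [set y | (q y <= t)%R]) g y).
have PhiE t : \int[m]_(y in [set y | (q y <= t)%R]) g y = (Phi t)%:E by exact: gE.
(* Levels above 1/8 suit [superlevel_small], and levels below 1/4 keep the given density bound. The
   window has length 1/8 and [Phi] grows by at most [I] on it, so any slope above [8 * I] would do;
   9 is used. *)
have [|s t st||t /andP[t8 t4] tP] := @good_level R Phi 8^-1 4^-1 (9 * I).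
- lra.
- rewrite -lee_fin -!PhiE; apply: ge0_subset_integral => //.
    exact: measurable_funTS.
  by move=> y /= qs; exact: le_trans st.
- have : (Phi 4^-1 <= I)%R by rewrite -lee_fin -PhiE gfinA.
  have : (0 <= Phi 8^-1)%R by rewrite -lee_fin -PhiE integral_ge0.
  lra.
pose E := [set y | (t < q y)%R].
have mE : measurable (E : set T) by exact: level_set_measurable.
pose ev y s := fine (mu (E `&` ball y s)).
have evE y s : mu (E `&` ball y s) = (ev y s)%:E.
  rewrite /ev fineK// ge0_fin_numE//.
  by rewrite (le_lt_trans _ (ball_finite Cd1 dbl y s))// le_outer_measure.
pose R0 := (r / (6 * lam))%R.
have R00 : (0 < R0)%R by rewrite divr_gt0// mulr_gt0.
have R0E : (6 * lam * R0 = r)%R by rewrite /R0 mulrC divfK// gt_eqF// mulr_gt0.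
have stop y : F y -> exists s, [/\ (0 < s)%R, (s <= R0)%R,
    (vol y s <= 2 * Cd * ev y s)%R & (2 * ev y s <= vol y s)%R].
  move=> [xy Fy].
  (* [S] collects the scales at which [E] has density at least 1/2. A member above half the supremum
     has its double outside [S], which is the stopping scale. *)
  pose S := [set s | (0 < s <= R0)%R /\ (vol y s <= 2 * ev y s)%R].
  have [s1 [s10 s1R Hs1]] := Fy R0 R00.
  have Ss1 : S s1.
    split; first by rewrite s10 ltW.
    rewrite -lee_fin; apply: (le_trans Hs1); rewrite EFinM -evE lee_wpmul2l//.
    by apply: le_outer_measure => z [/= qz sz]; split=> //; exact: lt_trans qz.
  have supS : has_sup S by split; [exists s1|exists R0 => s [/andP[]]].
  have ss1 : (s1 <= sup S)%R by apply: ub_le_sup => //; exact: supS.2.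
  have sup0 : (0 < sup S / 2)%R by rewrite divr_gt0// (lt_le_trans s10).
  have [s Ss sS] := sup_adherent sup0 supS.
  have [/andP[s0 sR] Hs] := Ss.
  have nS2 : ~ S (2 * s)%R.
    by move=> /(ub_le_sup supS.2); lra.
  have vs := vol_gt0 y s0.
  (* If [2 * s] exceeds [R0], then [vol y s] is comparable to [vol x r], and density 1/2 contradicts
     the smallness of [E]. Otherwise the density at [2 * s] is below 1/2, and by doubling still at
     least [1 / (2 * Cd)]. *)
  have [R2s|s2R] := ltP R0 (2 * s)%R.
    have ev1 : (ev y s <= K * r * I)%R.
      rewrite -lee_fin -evE; apply: le_trans (small x p r q g I t r0 xp mq q01 qD qg gI t8).
      by apply: le_outer_measure => z [].
    have xs : (vol x r <= Cb * vol y s)%R.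
      apply: le_trans (volCb y s s0); apply: vol_le => z.
      rewrite !ballEmdist/= => xz; move: xy; rewrite ballEmdist/= => xy.
      have := metric_triangle y x z; rewrite (metric_sym y x).
      have : (6 * lam * R0 < 6 * lam * (2 * s))%R by rewrite ltr_pM2l// mulr_gt0.
      lra.
    have k4 : (0 < 4 * K * Cb)%R by rewrite !mulr_gt0.
    have : (4 * K * Cb * (r * I) <= vol x r)%R.
      by rewrite -ler_pdivlMl//.
    have : (Cb * vol y s <= Cb * (2 * (K * r * I)))%R.
      by rewrite ler_pM2l//; lra.
    have := vol_gt0 x r0; lra.
  have s20 : (0 < 2 * s)%R by lra.
  exists (2 * s)%R; split=> //.
    have d := vol_double Cd1 dbl y s0.
    have e : (ev y s <= ev y (2 * s))%R.
      rewrite -lee_fin -!evE; apply: le_outer_measure; apply: setIS.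
      apply: le_ball; lra.
    have : (Cd * vol y s <= Cd * (2 * ev y (2 * s)))%R by rewrite ler_pM2l//; lra.
    lra.
  rewrite leNgt; apply/negP => H; apply: nS2; split; first by rewrite s20.
  exact: ltW.
have /choice[sr srP] : forall y, exists s, F y -> [/\ (0 < s)%R, (s <= R0)%R,
    (vol y s <= 2 * Cd * ev y s)%R & (2 * ev y s <= vol y s)%R].
  by move=> y; have [/stop[s sP]|nF] := pselect (F y); [exists s|exists 0%R].
pose w y := (Cc * vol y (sr y) / (3 * (lam * sr y)))%R.
apply: (@cap1_vitali _ _ mu hreg F _ (fun y => lam * sr y)%R w (lam * R0)%R) => //.
- exact: borel_ball.
- exact: (ball_finite Cd1 dbl).
- move=> y Fy; have [s0 sR _ _] := srP y Fy; split.
  + by rewrite mulr_gt0//= ler_pM2l.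
  + by rewrite divr_gt0// !mulr_gt0// vol_gt0.
  + move=> z; case: Fy => + _; rewrite !ballEmdist/= => xy yz.
    have := metric_triangle x y z.
    have : (6 * lam * sr y <= 6 * lam * R0)%R by rewrite ler_pM2l// mulr_gt0.
    lra.
  + rewrite [mu _]volE -EFinM lee_fin /w mulrC ler_wpM2r//.
      by rewrite invr_ge0 !mulr_ge0// ltW.
    by rewrite mulrA; exact: volCc.
move=> s us sF ts.
(* The threshold of [level_measure_half] depends on the ball, and the minimum over the finite family
   is positive. The level [t] was fixed before; only the width [h] is chosen after the balls. *)
have [h0 h00 Hh] : exists2 h0 : R, (0 < h0)%R & forall y, y \in s -> forall h,
    (0 < h)%R -> (h <= h0)%R -> mu (E `&` ball y (sr y)) <=
      2%:E * \int[m]_(z in ball y (sr y)) (clamp ((q z - t) / h))%:E.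
  elim: s {us sF ts} => [|y s [h1 h10 Hh1]]; first by exists 1%R.
  have [h2 h20 Hh2] := level_measure_half t mq (ball_cara hreg y (sr y))
    (ball_finite Cd1 dbl _ _).
  exists (Num.min h1 h2)%R => [|z]; first by rewrite lt_min h10.
  rewrite inE => /predU1P[->|zs] h h0; rewrite le_min => /andP[hh1 hh2].
    exact: Hh2.
  exact: Hh1.
have [h [/andP[hp hh0] Phih]] := tP h0 h00.
have t0 : (0 < t)%R by rewrite (lt_le_trans _ t8)// invr_gt0.
have ED y : (t < q y)%R -> ball x (2 * r) y.
  by move=> tq; apply: contrapT => /qD qy; move: tq; rewrite qy ltNge ltW.
have [g' wg' g'I] := truncation_ug hreg mq (borel_ball x (2 * r))
  (ball_finite Cd1 dbl _ _) ED qg hp.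
have [g'0 mg' _] := wg'.
have {}g'I : \int[m]_y g' y <= (11 * I)%:E.
  apply: (le_trans g'I).
  (* 9 from the good level, 2 from the two error terms of the truncation. *)
  have -> : (11 * I = h^-1 * (9 * I * h) + (I + I))%R by field; rewrite gt_eqF.
  rewrite EFinD EFinM; apply: leeD; last by rewrite EFinD; apply: leeD.
  rewrite lee_wpmul2l// ?lee_fin ?invr_ge0 ?(ltW hp)//.
  apply: le_trans (_ : (Phi (t + h) - Phi t)%:E <= _); last by rewrite lee_fin.
  rewrite EFinB leeBrDr// -!PhiE -ge0_integral_setU//.
  - apply: ge0_subset_integral => //.
    + apply: measurableU => //; exact: mlt.
    + exact: measurable_funTS.
    + move=> y [/= /andP[]//|/= qt]; rewrite (le_trans qt)// lerDl ltW//.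
  - exact: measurable_funTS.
  - by apply/disj_setPS => y [/= /andP[tq _] qt]; move: tq; rewrite ltNge qt.
have w01 y : (0 <= clamp ((q y - t) / h) <= 1)%R by exact: clamp_itv.
have mw : measurable_fun setT (fun y : T => clamp ((q y - t) / h)).
  by apply: measurable_clamp; apply: measurable_funM => //; exact: measurable_funB.
have each y : y \in s -> (vol y (sr y) / sr y)%:E <=
    (8 * Cd * CP)%:E * \int[m]_(z in ball y (lam * sr y)) g' z.
  move=> ys; have [s0 sR v1 v2] := srP y (set_mem (sF y ys)).
  set B := ball y (sr y).
  have mP0 : measurable (B `\` E : set T) by apply: measurableD => //; exact: ball_cara.
  (* At the stopping scale [E] fills at most half of the ball, so the truncation vanishes on at
     least half of it. *)
  have KP : (vol y (sr y))%:E <= 2%:E * mu (B `\` E).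
    have DI : mu B = mu (B `\` E) + mu (B `&` E).
      exact: (@measureDI _ _ _ m B E (ball_cara hreg _ _) mE).
    have BEfin : mu (B `\` E) \is a fin_num.
      rewrite ge0_fin_numE// (le_lt_trans _ (ball_finite Cd1 dbl y (sr y)))//.
      by apply: le_outer_measure => z [].
    move: DI; rewrite volE [B `&` E]setIC evE -(fineK BEfin) -EFinD -EFinM lee_fin.
    by move=> -[]; lra.
  have wP0 z : (B `\` E) z -> clamp ((q z - t) / h) = 0%R.
    move=> [_ nE]; apply: clamp0; rewrite pmulr_lle0 ?invr_gt0// subr_le0 leNgt.
    exact/negP.
  have P0B : B `\` E `<=` B by move=> z [].
  have := poincare_vanishing mw w01 wg' s0 P0B mP0 wP0 KP.
  set W := \int[m]_(z in ball y (sr y)) _; set G := \int[m]_(z in _) g' z => HW.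
  have HE := Hh y ys h hp (ltW hh0).
  have : (vol y (sr y))%:E <= (2 * Cd)%:E * (2%:E * ((2 * CP * sr y)%:E * G)).
    apply: (@le_trans _ _ ((2 * Cd)%:E * (ev y (sr y))%:E)).
      by rewrite -EFinM lee_fin.
    rewrite lee_wpmul2l//; first by rewrite lee_fin mulr_ge0// ltW.
    rewrite -evE; apply: (le_trans HE); by rewrite lee_wpmul2l.
  move=> Hv; have : (sr y)^-1%:E * (vol y (sr y))%:E <=
      (sr y)^-1%:E * ((2 * Cd)%:E * (2%:E * ((2 * CP * sr y)%:E * G))).
    by rewrite lee_wpmul2l// lee_fin invr_ge0 ltW.
  rewrite -EFinM mulrC !muleA -!EFinM; congr (_ <= _%:E * _); field.
  by rewrite gt_eqF.
have sumg' := @sum_integral_trivIset _ T _ m _ s (fun y => ball y (lam * sr y)) g'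
  (fun y => ball_cara hreg _ _) us ts (borel_fun_cara hreg mg') g'0.
rewrite -lee_fin -sumEFin.
apply: (@le_trans _ _ (\sum_(y <- s) (Cc / (3 * lam) * (8 * Cd * CP))%:E *
    \int[m]_(z in ball y (lam * sr y)) g' z)).
  rewrite big_seq [leRHS]big_seq; apply: lee_sum => y ys.
  have [s0 _ _ _] := srP y (set_mem (sF y ys)).
  have -> : w y = (Cc / (3 * lam) * (vol y (sr y) / sr y))%R.
    by rewrite /w; field; rewrite !gt_eqF.
  rewrite EFinM [X in _ <= X * _]EFinM -muleA lee_wpmul2l ?each//.
  by rewrite lee_fin divr_ge0 ?mulr_ge0// ltW.
rewrite -ge0_sume_distrr; last by move=> y _; apply: integral_ge0.
have CC : 0 <= (Cc / (3 * lam) * (8 * Cd * CP))%:E.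
  by rewrite lee_fin !mulr_ge0 ?invr_ge0 ?mulr_ge0// ltW.
apply: le_trans (lee_wpmul2l CC (le_trans sumg' g'I)) _.
by rewrite -EFinM lee_fin !mulrA.
Qed.

(** Two truncations of [q] are used. The one from 1/4 to 1/2 vanishes on half of the ball, so
    Poincare bounds the measure of the set where [q > 1/2]. The one from 1/2 to 1, cut off between
    [s] and [2 * s], is the test function: its gradient [2 * g + 1/s] lives on that set, which
    yields 2 from [g] and [16 * CP] from the cutoff. *)
Lemma cap1_le_integral (y : X) (s : R) (q : X -> R) (g : X -> \bar R) (A : set X) :
  (0 < s)%R -> measurable_fun setT (q : T -> R) -> (forall z, 0 <= q z <= 1)%R ->
  real_ug q g -> \int[m]_z g z < +oo -> (forall z, ball y s z -> A z -> q z = 1%R) ->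
  (vol y (2 * s))%:E <= 2%:E * mu ([set z | (q z <= 4^-1)%R] `&` ball y (2 * s)) ->
  cap1 mu (ball y s `&` A) (ball y (2 * s)) <=
    (2 + 16 * CP)%:E * \int[m]_(z in ball y (lam * (2 * s))) g z.
Proof.
move=> s0 mq q01 qg gfin qA half; have [g0 mg _] := qg.
have mgT := borel_fun_cara hreg mg.
have CP0 : (0 < CP)%R by exact: lt_le_trans CP1.
have s20 : (0 < 2 * s)%R by lra.
have ss : (s < 2 * s)%R by lra.
set B := ball y (2 * s); set G := \int[m]_(z in _) g z.
have mB : measurable (B : set T) by exact: ball_cara.
have BB : B `<=` ball y (lam * (2 * s)).
  by apply: le_ball; rewrite ler_peMl// ltW.
have BG : \int[m]_(z in B) g z <= G.
  by apply: ge0_subset_integral => //; [exact: ball_cara|exact: measurable_funTS].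
have G0 : 0 <= G by exact: integral_ge0.
pose step (t h : R) (z : X) : R := clamp ((q z - t) / h).
have step01 t h z : (0 <= step t h z <= 1)%R by exact: clamp_itv.
have mstep t h : measurable_fun setT (step t h : T -> R).
  by apply: measurable_clamp; apply: measurable_funM => //; exact: measurable_funB.
have stepug t h : (0 < h)%R -> real_ug (step t h) (fun z => h^-1%:E * g z).
  move=> h0; apply: (real_ug_lipschitz_comp qg); first by rewrite invr_ge0 ltW.
  move=> z z'; apply: le_trans (clamp_lip _ _) _.
  rewrite -mulrBl opprB addrA subrK normrM mulrC.
  by rewrite (@ger0_norm _ h^-1) ?invr_ge0 ?(ltW h0).
have h40 : (0 < 4^-1 :> R)%R by rewrite invr_gt0.
have h20 : (0 < 2^-1 :> R)%R by rewrite invr_gt0.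
pose E := [set z | (2^-1 < q z)%R].
have mE : measurable (E : set T) by exact: level_set_measurable.
have muE : mu (E `&` B) <= (16 * CP * s)%:E * G.
  have P0B : [set z | (q z <= 4^-1)%R] `&` B `<=` B by move=> z [].
  have mP0 : measurable ([set z | (q z <= 4^-1)%R] `&` B : set T).
    apply: measurableI => //.
    have := mq measurableT `]-oo, 4^-1%R]%classic (measurable_itv _).
    by rewrite setTI; congr measurable; apply/seteqP; split => z /=; rewrite in_itv/=.
  have P00 z : ([set z | (q z <= 4^-1)%R] `&` B) z -> step 4^-1%R 4^-1%R z = 0%R.
    by move=> [/= qz _]; apply: clamp0; rewrite pmulr_lle0 ?invr_gt0// subr_le0.
  have := poincare_vanishing (mstep _ _) (step01 _ _) (stepug 4^-1%R 4^-1%R h40)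
    s20 P0B mP0 P00 half.
  rewrite ge0_integralZl//; last 2 first.
  - exact: ball_cara.
  - exact: measurable_funTS.
  rewrite -/G invrK muleA -EFinM (_ : 2 * CP * (2 * s) * 4 = 16 * CP * s)%R; last by ring.
  apply: le_trans; apply: (@le_trans _ _ (\int[m]_(z in E `&` B) (step 4^-1%R 4^-1%R z)%:E)).
    rewrite -[leLHS]mul1e -integral_cst//; last exact: measurableI.
    apply: ge0_le_integral => //.
    - exact: measurableI.
    - by apply/measurable_EFinP; exact: measurable_funTS.
    - move=> z [+ _]; rewrite /E /= => qz; rewrite lee_fin /step clamp1// invrK; lra.
  apply: ge0_subset_integral => //.
  - exact: measurableI.
  - by apply/measurable_EFinP; exact: measurable_funTS.
  - by move=> z _; rewrite lee_fin; have /andP[] := step01 4^-1%R 4^-1%R z.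
pose eta := cutoff y s (2 * s).
have eta01 z : (0 <= eta z <= 1)%R by exact: clamp_itv.
have etaug : real_ug eta (cst s^-1%:E).
  by have := cutoff_ug y ss; rewrite (_ : 2 * s - s = s)%R//; lra.
pose p z := Num.min (step 2^-1%R 2^-1%R z) (eta z).
have p01 z : (0 <= p z <= 1)%R.
  have /andP[a0 a1] := step01 2^-1%R 2^-1%R z; have /andP[b0 b1] := eta01 z.
  by rewrite le_min a0 b0 ge_min a1.
have pug : real_ug p (fun z => 2^-1^-1%:E * g z + cst s^-1%:E z).
  apply: real_ugD (stepug 2^-1%R 2^-1%R h20) etaug _ => a b.
  by rewrite /p /Order.min; do ! case: ifPn; rewrite -?leNgt => *;
    rewrite ler_norml;
    have := ler_norm (step 2^-1%R 2^-1%R a - step 2^-1%R 2^-1%R b)%R;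
    have := ler_norm (step 2^-1%R 2^-1%R b - step 2^-1%R 2^-1%R a)%R;
    have := ler_norm (eta a - eta b)%R; have := ler_norm (eta b - eta a)%R;
    rewrite (distrC (step _ _ b)) (distrC (eta b)); lra.
have [S [mS ES NS]] := borel_hull hreg mE (borel_ball y (2 * s)) (ball_finite Cd1 dbl _ _).
have mST := borel_cara hreg mS.
have pS z : (0 < p z)%R -> (S `&` B) z.
  rewrite lt_min => /andP[/clamp_gt0]; rewrite pmulr_lgt0 ?invr_gt0// subr_gt0 => qz.
  by move=> /(cutoff_gt0 ss); split => //; exact: ES.
have muS : mu (S `&` B) <= (16 * CP * s)%:E * G.
  apply: le_trans muE.
  apply: (@le_trans _ _ (mu ((E `&` B) `|` (B `&` (S `\` E))))).
    apply: le_outer_measure => z [Sz Bz].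
    by have [Ez|nEz] := pselect (E z); [left|right].
  by apply: le_trans (outer_measureU2 mu _ _) _; rewrite NS adde0.
have I0 : (0 <= fine (\int[m]_z g z))%R by apply: fine_ge0; exact: integral_ge0.
have IE : \int[m]_z g z = (fine (\int[m]_z g z))%:E.
  by rewrite fineK// ge0_fin_numE ?integral_ge0.
apply/lee_addgt0Pr => e e0.
(* The error term of [real_ug_restrict] is [d * g], of total integral at most [e]. Any positive [d]
   excludes the curves along which [g] has infinite integral. *)
pose d := (e / (fine (\int[m]_z g z) + 1))%R.
have d0 : (0 < d)%R by rewrite divr_gt0// ltr_wpDl.
have fin gamma : curve_integral gamma (fun z => d%:E * g z) < +oo ->
    curve_integral gamma (fun z => 2^-1^-1%:E * g z + cst s^-1%:E z) < +oo.
  have mgc := @borel_fun_curve _ _ gamma _ mg.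
  rewrite /curve_integral ge0_integralZl//; last by rewrite lee_fin ltW.
  move=> H; rewrite ge0_integralD//; last 3 first.
  - by move=> x _; rewrite mule_ge0.
  - exact: measurable_funeM.
  - by move=> x _; rewrite lee_fin invr_ge0 ltW.
  rewrite ge0_integralZl// lte_add_pinfty//.
    rewrite lte_mul_pinfty//; move: H; rewrite !ltey; apply: contra => /eqP ->.
    by rewrite gt0_muley// lte_fin.
  by have := curve_integral_cst gamma s^-1; rewrite /curve_integral => ->; rewrite ltry.
have mdg : borel_fun (fun z => d%:E * g z) by exact: measurable_funeM.
have dg0 z : 0 <= d%:E * g z by rewrite mule_ge0// lee_fin ltW.
have pug2 := real_ug_restrict pug (fun z => (andP (p01 z)).1)
  (measurableI _ _ mS (borel_ball y (2 * s))) pS mdg dg0 fin.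
have pT : test_fun mu (ball y s `&` A) B p
    (fun z => ((fun z => 2^-1^-1%:E * g z + cst s^-1%:E z) \_ (S `&` B)) z + d%:E * g z).
  split => //.
  - by apply: (@measurable_minr _ T) => //; exact: measurable_cutoff.
  - move=> z [Bz Az]; rewrite /p /step (qA z)// clamp1 ?invrK; last by lra.
    by rewrite /eta cutoff1// ?minxx//; move: Bz; rewrite ballEmdist/= => /ltW.
  - move=> z nB; apply/eqP; rewrite eq_le; have /andP[-> _] := p01 z; rewrite andbT.
    by rewrite leNgt; apply/negP => /pS[].
apply: le_trans (cap1_le hreg (borel_ball y (2 * s)) (ball_finite Cd1 dbl _ _) pT) _.
have mSB : measurable (S `&` B : set T) by exact: measurableI.
have mH : measurable_fun setT ((fun z => 2^-1^-1%:E * g z + cst s^-1%:E z) : T -> \bar R).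
  by apply: emeasurable_funD => //; exact: measurable_funeM.
have H0 z : 0 <= 2^-1^-1%:E * g z + cst s^-1%:E z.
  by rewrite adde_ge0 ?mule_ge0// lee_fin invr_ge0 ltW.
have mHr := (@measurable_restrictT _ _ T _ _ _ mSB).1 (measurable_funTS mH).
rewrite ge0_integralD//; last 2 first.
- by move=> z _; exact: erestrict_ge0.
- exact: borel_fun_cara.
apply: leeD; last first.
  rewrite ge0_integralZl//; last by rewrite lee_fin ltW.
  rewrite IE -EFinM lee_fin /d -mulrA ler_piMr ?(ltW e0)//.
  by rewrite mulrC ler_pdivrMr ?ltr_wpDl// mul1r lerDl.
rewrite -integral_mkcond ge0_integralD//; last 3 first.
- by move=> z _; rewrite mule_ge0.
- by apply: measurable_funTS; exact: measurable_funeM.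
- by move=> z _; rewrite lee_fin invr_ge0 ltW.
rewrite integral_cst// ge0_integralZl//; last exact: measurable_funTS.
have -> : (2 + 16 * CP)%:E * G = 2%:E * G + (16 * CP)%:E * G.
  by rewrite EFinD ge0_muleDl// lee_fin ?mulr_ge0// ltW.
rewrite invrK; apply: leeD.
  rewrite lee_wpmul2l//; apply: le_trans BG; apply: ge0_subset_integral => //.
  exact: measurable_funTS.
have -> : (16 * CP)%:E * G = s^-1%:E * ((16 * CP * s)%:E * G).
  by rewrite muleA -EFinM; congr (_%:E * _); field; rewrite gt_eqF.
by rewrite lee_wpmul2l// lee_fin invr_ge0 ltW.
Qed.

(** * Thinness and the 1-fine topology *)

Lemma thinP (A : set X) (x : X) : thin mu A x <-> forall e, (0 < e)%R ->
  exists2 sigma, (0 < sigma)%R & forall s, (0 < s)%R -> (s < sigma)%R ->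
    s%:E * cap1 mu (ball x s `&` A) (ball x (2 * s)) <= (e * vol x s)%:E.
Proof.
pose f (s : R) := s%:E * cap1 mu (ball x s `&` A) (ball x (2 * s)) / mu (ball x s).
have f0 s : (0 < s)%R -> 0 <= f s.
  move=> s0; rewrite /f volE inver gt_eqF ?vol_gt0//.
  by rewrite !mule_ge0 ?cap1_ge0// lee_fin ?invr_ge0 ltW// vol_gt0.
have fE s e : (0 < s)%R -> (f s <= e%:E) =
    (s%:E * cap1 mu (ball x s `&` A) (ball x (2 * s)) <= (e * vol x s)%:E).
  by move=> s0; rewrite /f volE inver gt_eqF ?vol_gt0// lee_pdivrMr ?vol_gt0// -EFinM.
split=> [/fine_cvgP[ffin /cvgrPdist_le fcvg] e e0|H].
  have : \forall s \near (0 : R)^'+, f s <= e%:E.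
    near=> s.
    have s0 : (0 < s)%R by near: s; exact: nbhs_right_gt.
    have fs : f s \is a fin_num by near: s.
    rewrite -(fineK fs) lee_fin (le_trans (ler_norm _))//.
    rewrite -[fine (f s)]opprK normrN -[X in `|X|%R]sub0r.
    by near: s; exact: fcvg.
  rewrite near_withinE => -[/= sigma sigma0 Hs]; exists sigma => // s s0 ss.
  rewrite -fE//; apply: Hs => //=.
  by rewrite sub0r normrN ger0_norm// ltW.
apply/fine_cvgP; split.
  have [sigma sigma0 Hs] := H 1%R ltr01.
  near=> s; have s0 : (0 < s)%R by near: s; exact: nbhs_right_gt.
  have ss : (s < sigma)%R by near: s; exact: nbhs_right_lt.
  have := Hs s s0 ss; rewrite -fE// => fs.
  by rewrite ge0_fin_numE ?f0// (le_lt_trans fs)// ltry.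
apply/cvgrPdist_le => e e0; have [sigma sigma0 Hs] := H e e0.
near=> s; have s0 : (0 < s)%R by near: s; exact: nbhs_right_gt.
have ss : (s < sigma)%R by near: s; exact: nbhs_right_lt.
have := Hs s s0 ss; rewrite -fE// => fs; rewrite sub0r normrN -/(f s).
have ffin : f s \is a fin_num by rewrite ge0_fin_numE ?f0// (le_lt_trans fs)// ltry.
by rewrite ger0_norm ?fine_ge0 ?f0// -lee_fin fineK.
Unshelve. all: by end_near.
Qed.

(** In the constant [1 + C], 1 is for [A], tested by [q] itself, and [C] for the set [F] of the
    boxing argument; the sets [G k] have capacity 0. *)
Lemma cap1_base1 : exists delta C : R, [/\ (0 < delta)%R, (0 < C)%R &
  forall (x p : X) (r c : R) (A : set X), (0 < r)%R -> (4 * r <= mdist x p)%R ->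
  (0 < c)%R -> cap1 mu (ball x r `&` A) (ball x (2 * r)) < c%:E ->
  (r * c <= delta * vol x r)%R ->
  cap1 mu (ball x r `&` (A `|` base1 mu A)) (ball x (2 * r)) <= (C * c)%:E].
Proof.
have [delta [C [delta0 C0 boxing]]] := cap1_boxing.
have CP0 : (0 < CP)%R by exact: lt_le_trans CP1.
have lam0 : (0 < lam)%R by exact: lt_le_trans lam1.
exists delta, (1 + C)%R; split; [by []|by rewrite addr_gt0|].
move=> x p r c A r0 xp c0 /cap1_lt[q [g [[mq q01 qA qD qg] gc]]] rc.
have [g0 mg _] := qg.
have gfin : \int[m]_y g y < +oo by rewrite (lt_le_trans gc)// leey.
pose D := ball x (2 * r).
pose F := [set y | ball x r y /\ forall sigma, (0 < sigma)%R ->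
      exists s, [/\ (0 < s)%R, (s < sigma)%R &
        (vol y s)%:E <= 2%:E * mu ([set z | (4^-1 < q z)%R] `&` ball y s)]].
(* Discretizing the lower bound as [k.+1^-1] makes the exceptional set of the gradient a countable
   union. *)
pose G (k : nat) := [set y | ball x r y /\ forall sigma, (0 < sigma)%R ->
    exists s, [/\ (0 < s)%R, (s < sigma)%R &
      (k.+1%:R^-1 * vol y s)%:E <= s%:E * \int[m]_(z in ball y s) g z]].
have FC : cap1 mu F D <= (C * c)%:E.
  by apply: (boxing x p r q g c) => //; exact: ltW.
have G0 k : cap1 mu (G k) D = 0.
  by apply: (cap1_density_null) => //; rewrite invr_gt0 ltr0n.
have mD : measurable (D : set borelT) by exact: borel_ball.
have Dfin : mu D < +oo by exact: (ball_finite Cd1 dbl).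
have sub : ball x r `&` (A `|` base1 mu A) `<=`
    ((ball x r `&` A) `|` F) `|` \bigcup_k G k.
  move=> y [xy [Ay|by1]]; first by left; left.
  apply: contrapT => nS; apply: by1; apply/thinP => e e0.
  have nF : ~ F y by move=> Fy; apply: nS; left; right.
  have nG k : ~ G k y by move=> Gy; apply: nS; right; exists k.
  have [sF sF0 HF] : exists2 sigma, (0 < sigma)%R & forall s, (0 < s)%R -> (s < sigma)%R ->
      2%:E * mu ([set z | (4^-1 < q z)%R] `&` ball y s) < (vol y s)%:E.
    apply: contrapT => nsig; apply: nF; split=> // sigma sigma0.
    apply: contrapT => ns; apply: nsig; exists sigma => // s s0 ss.
    by rewrite ltNge; apply/negP => Hs; apply: ns; exists s.
  have [C2 C21 volC2] := vol_dilate Cd1 dbl (lam * 2).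
  have C20 : (0 < C2)%R by exact: lt_le_trans C21.
  (* Solves [(2 + 16 * CP) * c1 * C2 = lam * 2 * e]: the factors of [cap1_le_integral] and of the
     dilation by [lam * 2] reduce to [e]. *)
  pose c1 := (e * (lam * 2) / ((2 + 16 * CP) * C2))%R.
  have CC0 : (0 < (2 + 16 * CP) * C2)%R by rewrite mulr_gt0// addr_gt0// mulr_gt0.
  have c10 : (0 < c1)%R by rewrite divr_gt0// !mulr_gt0.
  pose k := Num.truncn c1^-1.
  have kc : (k.+1%:R^-1 <= c1)%R.
    rewrite -[leRHS]invrK lef_pV2 ?posrE ?invr_gt0// ?ltr0n//.
    by rewrite ltW// truncnS_gt.
  have [sG sG0 HG] : exists2 sigma, (0 < sigma)%R & forall s, (0 < s)%R -> (s < sigma)%R ->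
      s%:E * \int[m]_(z in ball y s) g z < (k.+1%:R^-1 * vol y s)%:E.
    apply: contrapT => nsig; apply: (nG k); split=> // sigma sigma0.
    apply: contrapT => ns; apply: nsig; exists sigma => // s s0 ss.
    by rewrite ltNge; apply/negP => Hs; apply: ns; exists s.
  have xy0 : (0 < r - mdist x y)%R by move: xy; rewrite ballEmdist/= subr_gt0.
  (* These bounds keep [ball y s] in [ball x r], where [q] is 1 on [A], and allow the density bound
     at scale [2 * s] and the gradient bound at scale [lam * 2 * s]. *)
  exists (Num.min (r - mdist x y) (Num.min (sF / 2) (sG / (lam * 2))))%R.
    by rewrite !lt_min xy0 !divr_gt0// mulr_gt0.
  move=> s s0; rewrite !lt_min => /and3P[sxy ssF ssG].
  have s20 : (0 < 2 * s)%R by lra.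
  have ls0 : (0 < lam * 2 * s)%R by rewrite !mulr_gt0.
  have half : (vol y (2 * s))%:E <=
      2%:E * mu ([set z | (q z <= 4^-1)%R] `&` ball y (2 * s)).
    have := HF (2 * s)%R s20; rewrite mulrC -ltr_pdivlMr// => /(_ ssF).
    rewrite mulrC.
    set B := ball y _; have mB : measurable (B : set T) by exact: ball_cara.
    have mE := level_set_measurable 4^-1%R mq.
    have fin A' : mu (A' `&` B) \is a fin_num.
      rewrite ge0_fin_numE// (le_lt_trans _ (ball_finite Cd1 dbl y (2 * s)))//.
      by apply: le_outer_measure => z [].
    have : mu B <= mu ([set z | (4^-1 < q z)%R] `&` B) +
        mu ([set z | (q z <= 4^-1)%R] `&` B).
      apply: le_trans (outer_measureU2 mu _ _); apply: le_outer_measure => z Bz.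
      by have [qz|qz] := leP (q z) 4^-1%R; [right|left].
    rewrite volE -(fineK (fin [set z | (4^-1 < q z)%R])).
    rewrite -(fineK (fin [set z | (q z <= 4^-1)%R])).
    rewrite -EFinD -!EFinM !lee_fin lte_fin; lra.
  have qA' z : ball y s z -> A z -> q z = 1%R.
    move=> yz Az; apply: qA; split=> //; move: yz; rewrite !ballEmdist/= => yz.
    have := metric_triangle x y z; lra.
  have := cap1_le_integral s0 mq q01 qg gfin qA' half; rewrite mulrA => Hcap.
  have ssG' : (lam * 2 * s < sG)%R by rewrite mulrC -ltr_pdivlMr// mulr_gt0.
  have HI := HG (lam * 2 * s)%R ls0 ssG'.
  set J := \int[m]_(z in _) g z in Hcap HI.
  have Jfin : J \is a fin_num.
    rewrite ge0_fin_numE ?integral_ge0// (le_lt_trans _ gfin)//.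
    apply: ge0_subset_integral => //; first exact: ball_cara.
    exact: borel_fun_cara.
  move: Hcap HI; rewrite -(fineK Jfin); set j := fine J => Hcap HI.
  apply: le_trans (lee_wpmul2l _ Hcap) _; first by rewrite lee_fin ltW.
  move: HI; rewrite -!EFinM lte_fin lee_fin => HI.
  have v1 : (k.+1%:R^-1 * vol y (lam * 2 * s) <= c1 * (C2 * vol y s))%R.
    apply: ler_pM => //.
    - by rewrite ltW// vol_gt0.
    - exact: volC2.
  have : ((2 + 16 * CP) * (lam * 2 * s * j) <= (2 + 16 * CP) * (c1 * (C2 * vol y s)))%R.
    by rewrite ler_pM2l//; [exact: le_trans (ltW HI) v1|lra].
  have -> : ((2 + 16 * CP) * (c1 * (C2 * vol y s)) = (lam * 2) * (e * vol y s))%R.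
    by rewrite /c1; field; rewrite !gt_eqF ?addr_gt0 ?mulr_gt0.
  have -> : ((2 + 16 * CP) * (lam * 2 * s * j) =
      (lam * 2) * (s * ((2 + 16 * CP) * j)))%R by ring.
  by rewrite ler_pM2l// mulr_gt0.
apply: (le_trans (cap1_mono _ _ sub)).
apply: le_trans (cap1U hreg _ _ mD Dfin) _.
have -> : ((1 + C) * c)%:E = (c%:E + (C * c)%:E) + 0 by rewrite adde0 mulrDl mul1r.
apply: leeD.
  apply: le_trans (cap1U hreg _ _ mD Dfin) _; apply: leeD => //.
  have tq : test_fun mu (ball x r `&` A) D q g by [].
  exact: le_trans (cap1_le hreg mD Dfin tq) (ltW gc).
apply: le_trans (cap1_bigcup hreg _ mD Dfin) _.
by rewrite eseries0// => k _ _; exact: G0.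
Qed.

Lemma thinS (A B : set X) (x : X) : A `<=` B -> thin mu B x -> thin mu A x.
Proof.
move=> AB /thinP HB; apply/thinP => e /HB[sigma sigma0 H]; exists sigma => // s s0 ss.
apply: le_trans (H s s0 ss); rewrite lee_wpmul2l ?lee_fin ?(ltW s0)//.
by apply: cap1_mono; exact: setIS.
Qed.

Lemma thin_setU_base1 (A : set X) (x : X) : (exists x y : X, x <> y) ->
  thin mu A x -> thin mu (A `|` base1 mu A) x.
Proof.
move=> [a [b ab]] /thinP tA; have [p xp] : exists p, x <> p.
  by have [xa|] := pselect (x = a); [exists b; rewrite xa|exists a].
have d0 : (0 < mdist x p)%R by rewrite mdist_gt0; apply/eqP.
have [delta [C [delta0 C0 H]]] := cap1_base1.
apply/thinP => e e0.
(* [cap1_base1] requires a strict bound [c] on the capacity, so [c] is taken with twice the ratio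
   that thinness gives; this accounts for both factors 2. *)
pose e' := (Num.min (delta / 2) (e / (2 * C)))%R.
have e'0 : (0 < e')%R by rewrite lt_min !divr_gt0// mulr_gt0.
have e'd : (2 * e' <= delta)%R.
  have : (e' <= delta / 2)%R by rewrite ge_min lexx.
  lra.
have e'e : (C * (2 * e') <= e)%R.
  have : (e' <= e / (2 * C))%R by rewrite ge_min lexx orbT.
  rewrite ler_pdivlMr ?mulr_gt0//; lra.
have [sigma sigma0 Hs] := tA e' e'0.
exists (Num.min sigma (mdist x p / 4))%R; first by rewrite lt_min sigma0 divr_gt0.
move=> s s0; rewrite lt_min => /andP[ss sp].
have vs := vol_gt0 x s0.
pose c := (2 * e' * vol x s / s)%R.
have c0 : (0 < c)%R by rewrite divr_gt0// !mulr_gt0.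
have sc : (s * c = 2 * e' * vol x s)%R by rewrite /c mulrC divfK// gt_eqF.
have capc : cap1 mu (ball x s `&` A) (ball x (2 * s)) < c%:E.
  rewrite ltNge; apply/negP => Hc; have := Hs s s0 ss; apply/negP; rewrite -ltNge.
  apply: (@lt_le_trans _ _ (s%:E * c%:E)); last by rewrite lee_wpmul2l// lee_fin ltW.
  rewrite -EFinM lte_fin sc; have : (0 < e' * vol x s)%R by rewrite mulr_gt0.
  lra.
have {}H' : cap1 mu (ball x s `&` (A `|` base1 mu A)) (ball x (2 * s)) <= (C * c)%:E.
  apply: (H x p s c A s0 _ c0 capc); first by lra.
  by rewrite sc ler_wpM2r// ltW.
apply: (@le_trans _ _ (s%:E * (C * c)%:E)); first by rewrite lee_wpmul2l// lee_fin ltW.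
rewrite -EFinM lee_fin mulrCA sc mulrA mulrA -[X in (X * _)%R]mulrA ler_wpM2r//.
exact: ltW.
Qed.

(** At a point outside the union [A] is thin, hence so is the union, by [thin_setU_base1]: the union
    is finely closed. It is the smallest such set because a finely closed set containing [A] is
    thin, and with it [A], at each point outside. *)
Lemma fine_closureE (A : set X) : (exists x y : X, x <> y) ->
  fine_closure mu A = A `|` base1 mu A.
Proof.
move=> two; apply/seteqP; split.
- apply: smallest_sub; last exact: subsetUl.
  move=> x nx; rewrite setCK; apply: thin_setU_base1 => //.
  by apply: contrapT => nt; apply: nx; right.
- move=> x Ax F [cF AF]; apply: contrapT => nFx.
  have := cF x nFx; rewrite setCK => /(thinS AF) tA.
  by case: Ax => [/AF //|]; exact.
Qed.

Lemma fine_intE (A : set X) : (exists x y : X, x <> y) ->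
  fine_int mu A = A `\` base1 mu (~` A).
Proof.
move=> two; apply/seteqP; split=> [x [U [oU UA] Ux]|x [Ax nb]].
- split; first exact: UA.
  by apply; apply: thinS (oU x Ux); exact: subsetC.
(* The complement of the fine closure of the complement of [A]. *)
- exists (~` (~` A `|` base1 mu (~` A))); last by move=> [|].
  split; last by move=> y ny; apply: contrapT => nA; apply: ny; left.
  move=> y ny; rewrite setCK; apply: thin_setU_base1 => //.
  by apply: contrapT => nt; apply: ny; right.
Qed.

Lemma fine_boundaryE (A : set X) : (exists x y : X, x <> y) ->
  fine_boundary mu A =
    (A `&` base1 mu (~` A)) `|` (~` A `&` base1 mu A).
Proof.
move=> two; rewrite /fine_boundary fine_closureE// fine_intE//.
apply/seteqP; split=> [x [Ab nA]|x [[Ax bx]|[nAx bx]]].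
- have [Ax|nAx] := pselect (A x).
    by left; split=> //; apply: contrapT => nb; apply: nA.
  by right; split=> //; case: Ab.
- by split; [left|case].
- by split; [right|case].
Qed.

End poincare.

Theorem corollary3p7 (R : realType) (X : completePMetricType R)
  (mu : {outer_measure set X -> \bar R})
  (htwo : exists x y : X, x <> y)
  (hreg : borel_regular mu)
  (hdoubling : doubling mu)
  (hpoincare : poincare11 mu)
  (A : set X) :
  fine_closure mu A = A `|` base1 mu A /\
  fine_boundary mu A =
    (A `&` base1 mu (~` A)) `|` (~` A `&` base1 mu A).
Proof.
have [Cd Cd1 dbl] := hdoubling; have [CP [lam [CP1 lam1 poincare]]] := hpoincare.
split.
- exact: (fine_closureE hreg Cd1 dbl CP1 lam1 poincare).
- exact: (fine_boundaryE hreg Cd1 dbl CP1 lam1 poincare).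
Qed.
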